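(* The image of the Lie algebra of geometric derivations $\mathfrak u^{\mathrm{geom}}$ under the linear map $\overline{\ell'}$ consists of solutions to the linearised double shuffle equations: $$\overline{\ell'}(\mathfrak u^{\mathrm{geom}})\subset\mathfrak{pls}.$$
   Context: $\mathbb L(a,b)$ is the free Lie algebra over $\mathbb Q$ on $a,b$, embedded in the tensor algebra $T(a,b)$, and $\mathrm{Der}^\Theta\,\mathbb L(a,b)$ is the Lie algebra of derivations $\delta$ with $\delta([a,b])=0$. For $n\ge-1$, $\varepsilon^\vee_{2n+2}\in\mathrm{Der}^\Theta\,\mathbb L(a,b)$ is the unique derivation with $\varepsilon^\vee_{2n+2}(a)=\mathrm{ad}(a)^{2n+2}(b)$, $\varepsilon^\vee_{2n+2}([a,b])=0$, and such that the coefficient of $a$ in $\varepsilon^\vee_{2n+2}(b)$ is $0$. $\mathfrak u^{\mathrm{geom}}\subset\mathrm{Der}^\Theta\,\mathbb L(a,b)$ is the Lie subalgebra generated by all $\varepsilon^\vee_{2n+2}$, $n\ge-1$. For every $\delta\in\mathfrak u^{\mathrm{geom}}$ each term of $\delta(a)$ has degree $\ge1$ in $b$. The map $\overline{\ell'}$ sends $\delta$ to the sequence, indexed by $r\ge1$, of rational functions obtained from the component of $\delta(a)$ of degree $r$ in $b$ by the linear map $$a^{i_0}ba^{i_1}b\cdots ba^{i_r}\mapsto\begin{cases}\dfrac{x_1^{i_1}\cdots x_r^{i_r}}{x_1(x_1-x_2)(x_2-x_3)\cdots(x_{r-1}-x_r)x_r}& i_0=0,\\ 0& i_0>0,\end{cases}$$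 (for $r=1$ the denominator is $x_1^2$). $\mathfrak{pls}$ is the direct sum over $r\ge1$ of the spaces of rational functions $f\in\frac{1}{x_1(x_1-x_2)\cdots(x_{r-1}-x_r)x_r}\mathbb Q[x_1,\dots,x_r]$ that satisfy the linearised double shuffle equations in depth $r$: for $r=1$, $f(x_1)=f(-x_1)$; for $r\ge2$ and every $1\le k<r$, $$\sum_{z}f(z)=0\qquad\text{and}\qquad\sum_z f^\sharp(z)=0,$$ where $z$ runs over all shuffles of the sequences $(x_1,\dots,x_k)$ and $(x_{k+1},\dots,x_r)$ and $f^\sharp(z_1,\dots,z_r)=f(z_1,z_1+z_2,\dots,z_1+\cdots+z_r)$. *)

(* Defs.v *)
From HB Require Import structures.
From mathcomp Require Import all_boot all_order all_algebra fingroup perm.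
From mathcomp Require Import boolp classical_sets functions.
From mathcomp Require finmap.
From mathcomp Require Import monalg.
From mathcomp Require Import mpoly.

Set Implicit Arguments.
Unset Strict Implicit.
Unset Printing Implicit Defensive.

Import GRing.Theory.
Local Open Scope ring_scope.

Local Notation "x %:F" := (@FracField.tofrac _ x).

(* The letters a and b are encoded as booleans, so that a word is an element
   of the free monoid {fmonom bool} (with a coercion to seq bool) and T(a,b)
   is the monoid algebra of that free monoid. *)
Definition letter_a : bool := false.
Definition letter_b : bool := true.

Definition word := {fmonom bool}.
Definition tensor := {malg rat[word]}.

Definition coeff (w : word) (t : tensor) : rat := monalg.mcoeff w t.
Definition words_of (t : tensor) : seq word := finmap.enum_fset (monalg.msupp t).

Definition tensor_a : tensor := monalg.mkmalgU (fmu letter_a) 1.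
Definition tensor_b : tensor := monalg.mkmalgU (fmu letter_b) 1.

Definition tensor_bracket (x y : tensor) : tensor := x * y - y * x.

(* L(a,b) as the Lie subalgebra of T(a,b) generated by a and b. *)
Inductive in_lie : tensor -> Prop :=
| in_lie_a : in_lie tensor_a
| in_lie_b : in_lie tensor_b
| in_lie_lin (c : rat) x y : in_lie x -> in_lie y -> in_lie (c *: x + y)
| in_lie_bracket x y : in_lie x -> in_lie y -> in_lie (tensor_bracket x y).

Definition lie_pred : {pred tensor} := fun x => `[< in_lie x >].

Lemma lie_submod_closed : submod_closed lie_pred.
Proof.
split=> [|c x y /asboolP xL /asboolP yL]; last exact/asboolP/in_lie_lin.
apply/asboolP; rewrite -[0](addNr tensor_a) -scaleN1r.
by apply: in_lie_lin; exact: in_lie_a.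
Qed.

HB.instance Definition _ :=
  GRing.isSubmodClosed.Build rat tensor lie_pred lie_submod_closed.

Record lie := Lie { lie_val :> tensor; lie_valP : lie_val \in lie_pred }.

HB.instance Definition _ := [isSub for lie_val].
HB.instance Definition _ := [Choice of lie by <:].
HB.instance Definition _ := [SubChoice_isSubZmodule of lie by <:].
HB.instance Definition _ := [SubZmodule_isSubLmodule of lie by <:].

Lemma lie_a_subproof : tensor_a \in lie_pred.
Proof. exact/asboolP/in_lie_a. Qed.

Lemma lie_b_subproof : tensor_b \in lie_pred.
Proof. exact/asboolP/in_lie_b. Qed.

Lemma lie_bracket_subproof (x y : lie) :
  tensor_bracket (lie_val x) (lie_val y) \in lie_pred.
Proof.
by apply/asboolP/in_lie_bracket; apply/asboolP; apply: lie_valP.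
Qed.

Definition lie_a : lie := Lie lie_a_subproof.
Definition lie_b : lie := Lie lie_b_subproof.
Definition lie_bracket (x y : lie) : lie := Lie (lie_bracket_subproof x y).

Definition is_derivation (delta : lie -> lie) : Prop :=
  linear delta /\
  forall x y, delta (lie_bracket x y) =
    lie_bracket (delta x) y + lie_bracket x (delta y).

Definition Der_Theta : set (lie -> lie) :=
  [set delta | is_derivation delta /\ delta (lie_bracket lie_a lie_b) = 0].

Definition der_bracket (delta1 delta2 : lie -> lie) : lie -> lie :=
  fun x => delta1 (delta2 x) - delta2 (delta1 x).

(* delta is the derivation epsilon^\vee_{2m}; with m = n + 1 this covers
   epsilon^\vee_{2n+2} for all n >= -1. *)
Definition is_epsilon (m : nat) (delta : lie -> lie) : Prop :=
  [/\ Der_Theta delta,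
      delta lie_a = iter m.*2 (lie_bracket lie_a) lie_b &
      coeff (fmu letter_a) (lie_val (delta lie_b)) = 0].

Inductive in_u_geom : (lie -> lie) -> Prop :=
| u_geom_epsilon m delta : is_epsilon m delta -> in_u_geom delta
| u_geom_lin (c : rat) delta1 delta2 :
    in_u_geom delta1 -> in_u_geom delta2 -> in_u_geom (c *: delta1 + delta2)
| u_geom_bracket delta1 delta2 :
    in_u_geom delta1 -> in_u_geom delta2 ->
    in_u_geom (der_bracket delta1 delta2).

Definition u_geom : set (lie -> lie) := [set delta | in_u_geom delta].

(* Depth r >= 1 is written r = d.+1, and the variable x_(i+1) is 'X_i for
   i : 'I_d.+1. (The notation {mpoly rat[d.+1]} is ambiguous here, as monalg
   declares it too.) *)
Notation polynom d := (mpoly.mpoly d.+1 rat).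
Definition ratfun (d : nat) := {fraction (polynom d)}.

(* x_1 (x_1 - x_2) ... (x_(r-1) - x_r) x_r, which is x_1 ^+ 2 if r = 1 *)
Definition pls_denom (d : nat) : polynom d :=
  'X_ord0 *
  (\prod_(i < d) ('X_(widen_ord (leqnSn d) i) - 'X_(lift ord0 i))) *
  'X_ord_max.

(* The sequence of exponents [:: i_0; i_1; ...; i_r] of the word
   a^(i_0) b a^(i_1) b ... b a^(i_r). *)
Fixpoint exponents (w : seq bool) : seq nat :=
  if w is l :: w' then
    if l == letter_b then 0%N :: exponents w'
    else incr_nth (exponents w') 0
  else [:: 0%N].

Definition ell_word (d : nat) (w : word) : ratfun d :=
  if nth 0%N (exponents w) 0 == 0%N then
    (\prod_(j < d.+1) ('X_j : polynom d) ^+ nth 0%N (exponents w) j.+1)%:F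
      / (pls_denom d)%:F
  else 0.

Definition ell_bar (delta : lie -> lie) : forall d : nat, ratfun d :=
  fun d =>
    let t := lie_val (delta lie_a) in
    \sum_(w <- words_of t | count_mem letter_b (w : seq bool) == d.+1)
       ((coeff w t)%:MP_[d.+1])%:F * ell_word d w.

(* f(z_1, ..., z_r). The substitution is applied to a representative
   numerator / denominator pair of f; the result does not depend on the
   representative when p |-> p(z_1, ..., z_r) is injective on polynomials,
   which holds for all the substitutions used below since they are invertible
   and linear. *)
Definition ratfun_subst (d : nat) (f : ratfun d) (z : 'I_d.+1 -> polynom d) :
    ratfun d :=
  let zs := [tuple z i | i < d.+1] in
  (\n_(generic_quotient.repr f) \mPo zs)%:F / (\d_(generic_quotient.repr f) \mPo zs)%:F.

Definition sharp (d : nat) (f : ratfun d) : ratfun d :=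
  ratfun_subst f (fun i => \sum_(j < d.+1 | (j <= i)%N) 'X_j).

(* (x_(s 1), ..., x_(s r)) is a shuffle of (x_1, ..., x_k) and
   (x_(k+1), ..., x_r): the position s^-1 i of x_i is increasing in i on both
   blocks. *)
Definition is_shuffle (d k : nat) (s : 'S_d.+1) : bool :=
  [forall i : 'I_d.+1, forall j : 'I_d.+1,
     ((i < j)%N && ((i < k)%N == (j < k)%N)) ==>
       ((s^-1)%g i < (s^-1)%g j)%N].

Definition shuffle_sum (d k : nat) (f : ratfun d) : ratfun d :=
  \sum_(s : 'S_d.+1 | is_shuffle k s) ratfun_subst f (fun i => 'X_(s i)).

Definition lin_double_shuffle (d : nat) (f : ratfun d) : Prop :=
  (d = 0%N -> f = ratfun_subst f (fun i => - 'X_i)) /\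
  ((0 < d)%N -> forall k : nat, (0 < k < d.+1)%N ->
     shuffle_sum k f = 0 /\ shuffle_sum k (sharp f) = 0).

Definition pls_depth (d : nat) : set (ratfun d) :=
  [set f | (exists p : polynom d, f = p%:F / (pls_denom d)%:F) /\
           lin_double_shuffle f].

(* The direct sum over all depths: sequences with finitely many nonzero
   components. *)
Definition pls : set (forall d : nat, ratfun d) :=
  [set f | (forall d, pls_depth (f d)) /\
           exists N : nat, forall d, (N < d)%N -> f d = 0].

(* Main.v *)
From HB Require Import structures.
From mathcomp Require Import all_boot all_order all_algebra fingroup perm.
From mathcomp Require Import boolp classical_sets functions.
From mathcomp Require finmap.
From mathcomp Require Import monalg.
From mathcomp Require Import mpoly.
From mathcomp Require Import ring.
Require Import Defs.

(** Fix pairwise distinct points x_0, ..., x_n of a field of characteristic 0.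
    Let [a] act by the diagonal matrix of the points, [b] by the superdiagonal
    matrix with entries 1 / (x_i - x_(i+1)). The entry from x_0 to x_n of an
    element t of T(a,b), written [eval], is the polynomial of the part of t of
    degree n in b divided by the product of the x_i - x_(i+1). For a derivation
    delta, let F(x_0, ..., x_n) be this entry for delta(a), divided by x_n - x_0
    ([der_eval]). Then the depth n component of the image of delta is
    - F(0, x_1, ..., x_n) ([ratfun_subst_ell]), and the two families of
    equations say that F(0, .) vanishes on proper shuffles (is alternal) both as
    a function of the points x_1, ..., x_n and as a function of the differences
    x_1, x_2 - x_1, ..., x_n - x_(n-1).

    Alternality in the differences holds because delta(a) is a Lie element: by
    induction on Lie elements, [eval] is translation invariant and alternal in
    the differences ([lie_series_exists]), and the extra denominators are
    symmetric in them.

    Alternality in the points uses derivations. As [a,b] acts by the shift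
    matrix, delta([a,b]) = 0 says that F is invariant under cyclic rotation of
    its arguments ([der_eval_rot1]). By definition [F, a] = delta(a), so
    delta - [F, .] kills a and is determined by its value at [a,b], which is the
    commutator of the shift with F; this gives delta on all Lie elements
    ([eval_der]) and then F for a bracket of two derivations
    ([der_eval_bracket]). With cyclic invariance all terms of that formula fit
    together ([bracket_detour_cyclic]): F is the sum, over all points c of the
    circle x_0, ..., x_n, of the commutator of F2(c, .) and F1(c, .) evaluated
    at the other points, read from c onwards. Commutators of alternal functions
    are alternal ([alternal_commutator]), and a function of cyclic words that is
    alternal after cutting at one letter is alternal after cutting at any other
    letter ([alternal_rotation]). So alternality passes to brackets; the
    generators live in depth one, where it says nothing.

    In depth one, evenness is F(0, x) = F(x, 0) = F(0, - x), by rotation and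
    translation. *)

Set Implicit Arguments.
Unset Strict Implicit.
Unset Printing Implicit Defensive.

Import GRing.Theory.
Local Open Scope ring_scope.

Local Notation "x %:F" := (@FracField.tofrac _ x).

(** * Shuffles and deconcatenations of words *)

Section ShuffleDefs.
Variable T : Type.
Implicit Types (s t : seq T).

Fixpoint shuffles s : seq T -> seq (seq T) :=
  if s is x :: s' then
    fix shuffles_s t :=
      if t is y :: t' then
        map (cons x) (shuffles s' t) ++ map (cons y) (shuffles_s t')
      else [:: s]
  else fun t => [:: t].

Fixpoint splits s : seq (seq T * seq T) :=
  if s is x :: s' then
    ([::], s) :: map (fun p => (x :: p.1, p.2)) (splits s')
  else [:: ([::], [::])].

Fixpoint cuts s : seq (seq T * T * seq T) :=
  if s is x :: s' then
    ([::], x, s') :: map (fun p => (x :: p.1.1, p.1.2, p.2)) (cuts s')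
  else [::].

Lemma shuffles_s0 s : shuffles s [::] = [:: s].
Proof. by case: s. Qed.

Lemma shuffles_cons x s y t :
  shuffles (x :: s) (y :: t) =
  map (cons x) (shuffles s (y :: t)) ++ map (cons y) (shuffles (x :: s) t).
Proof. by []. Qed.

End ShuffleDefs.

Arguments shuffles : simpl never.
Arguments splits : simpl never.
Arguments cuts : simpl never.

Section ShuffleSums.
Variables (T : Type) (V : comNzRingType).
Implicit Types (s t : seq T) (G : seq T -> V).

Lemma sum_shuffles_cons G x s y t :
  \sum_(w <- shuffles (x :: s) (y :: t)) G w =
  \sum_(w <- shuffles s (y :: t)) G (x :: w) +
  \sum_(w <- shuffles (x :: s) t) G (y :: w).
Proof. by rewrite shuffles_cons big_cat !big_map. Qed.

Lemma sum_shuffles_s0 G s : \sum_(w <- shuffles s [::]) G w = G s.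
Proof. by rewrite shuffles_s0 big_seq1. Qed.

Lemma sum_shuffles_0s G s : \sum_(w <- shuffles [::] s) G w = G s.
Proof. by rewrite big_seq1. Qed.

Lemma sum_splits_cons (P : seq T * seq T -> V) x s :
  \sum_(p <- splits (x :: s)) P p =
  P ([::], x :: s) + \sum_(p <- splits s) P (x :: p.1, p.2).
Proof. by rewrite big_cons big_map. Qed.

Lemma sum_splits0 (P : seq T * seq T -> V) :
  \sum_(p <- splits [::]) P p = P ([::], [::]).
Proof. by rewrite big_seq1. Qed.

Lemma sum_cuts_cons (P : seq T * T * seq T -> V) x s :
  \sum_(p <- cuts (x :: s)) P p =
  P ([::], x, s) + \sum_(p <- cuts s) P (x :: p.1.1, p.1.2, p.2).
Proof. by rewrite big_cons big_map. Qed.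

Lemma sum_cuts0 (P : seq T * T * seq T -> V) :
  \sum_(p <- cuts [::]) P p = 0.
Proof. by rewrite big_nil. Qed.

Lemma sum_shufflesC G s t :
  \sum_(w <- shuffles s t) G w = \sum_(w <- shuffles t s) G w.
Proof.
elim: s t G => [|x s IHs] t G; first by rewrite sum_shuffles_0s sum_shuffles_s0.
elim: t G => [|y t IHt] G; first by rewrite sum_shuffles_s0.
by rewrite !sum_shuffles_cons IHs IHt addrC.
Qed.

(** Associativity and commutativity of the shuffle product, in the one form
    that the triple deconcatenation in [alternal_rotation] needs. *)
Lemma sum_shufflesAC G s t r :
  \sum_(w <- shuffles s t) \sum_(z <- shuffles w r) G z =
  \sum_(w <- shuffles s r) \sum_(z <- shuffles w t) G z.
Proof.
elim: s t r G => [|x s IHs] t r G.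
  by rewrite !sum_shuffles_0s sum_shufflesC.
elim: t r G => [|y t IHt] r G.
  by rewrite sum_shuffles_s0; apply: eq_bigr => w _; rewrite sum_shuffles_s0.
elim: r G => [|z r IHr] G.
  by rewrite sum_shuffles_s0; apply: eq_bigr => w _; rewrite sum_shuffles_s0.
rewrite !sum_shuffles_cons.
under eq_bigr do rewrite sum_shuffles_cons.
under [X in _ + X]eq_bigr do rewrite sum_shuffles_cons.
under [in RHS]eq_bigr do rewrite sum_shuffles_cons.
under [X in _ = _ + X]eq_bigr do rewrite sum_shuffles_cons.
rewrite !big_split /= IHs IHt.
have := IHr (fun w => G (z :: w)); rewrite !sum_shuffles_cons => IHr'.
by rewrite -IHr'; ring.
Qed.

(** Deconcatenation is multiplicative for the shuffle product. *)
Lemma sum_shuffles_splits (P : seq T * seq T -> V) s t :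
  \sum_(w <- shuffles s t) \sum_(p <- splits w) P p =
  \sum_(p <- splits s) \sum_(q <- splits t)
    \sum_(u <- shuffles p.1 q.1) \sum_(v <- shuffles p.2 q.2) P (u, v).
Proof.
elim: s t P => [|x s IHs] t P.
  rewrite sum_shuffles_0s sum_splits0; apply: eq_bigr => q _.
  by rewrite !sum_shuffles_0s; case: q.
elim: t P => [|y t IHt] P.
  rewrite sum_shuffles_s0; apply: eq_bigr => q _.
  by rewrite sum_splits0 !sum_shuffles_s0; case: q.
rewrite sum_shuffles_cons.
under eq_bigr do rewrite sum_splits_cons.
under [X in _ + X]eq_bigr do rewrite sum_splits_cons.
rewrite !big_split /= IHs IHt.
rewrite !sum_splits_cons /=.
under [X in _ + X + _ = _]eq_bigr do rewrite sum_splits_cons.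
under [X in _ = _ + X]eq_bigr do rewrite sum_splits_cons.
rewrite !sum_shuffles_0s !big_split /= sum_shuffles_cons.
under [X in _ = _ + (_ + X)]eq_bigr => p _.
  under eq_bigr do rewrite sum_shuffles_cons.
  rewrite big_split /=.
  over.
rewrite big_split /=.
under [X in _ + (X + _) + _ = _]eq_bigr do rewrite sum_shuffles_s0.
under [X in _ = _ + (X + _)]eq_bigr do rewrite sum_shuffles_s0.
under [X in _ = _ + X + _]eq_bigr do rewrite sum_shuffles_0s.
under [X in _ + (_ + (X + _)) = _]eq_bigr do rewrite sum_shuffles_0s.
ring.
Qed.

Lemma eq_sum_splits (P Q : seq T * seq T -> V) s :
  (forall u v, s = u ++ v -> P (u, v) = Q (u, v)) ->
  \sum_(p <- splits s) P p = \sum_(p <- splits s) Q p.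
Proof.
elim: s P Q => [|x s IHs] P Q PQ; first by rewrite !sum_splits0 PQ.
rewrite !sum_splits_cons PQ //; congr (_ + _).
apply: (IHs (fun p => P (x :: p.1, p.2)) (fun p => Q (x :: p.1, p.2))) => u v.
by move=> def_s; apply: PQ; rewrite def_s.
Qed.

Lemma eq_sum_cuts (P Q : seq T * T * seq T -> V) s :
  (forall u c v, s = u ++ c :: v -> P (u, c, v) = Q (u, c, v)) ->
  \sum_(p <- cuts s) P p = \sum_(p <- cuts s) Q p.
Proof.
elim: s P Q => [|x s IHs] P Q PQ; first by rewrite !sum_cuts0.
rewrite !sum_cuts_cons PQ //; congr (_ + _).
apply: (IHs (fun p => P (x :: p.1.1, p.1.2, p.2))
  (fun p => Q (x :: p.1.1, p.1.2, p.2))) => u c v def_s.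
by apply: PQ; rewrite def_s.
Qed.

(** This and [sum_splits_last] collapse a sum in which alternality kills all
    deconcatenations but an extreme one. *)
Lemma sum_splits_first (P : seq T * seq T -> V) s :
  (forall u v, s = u ++ v -> (0 < size u)%N -> P (u, v) = 0) ->
  \sum_(p <- splits s) P p = P ([::], s).
Proof.
case: s => [|x s] P0; first by rewrite sum_splits0.
rewrite sum_splits_cons (eq_sum_splits (Q := fun=> 0)) ?big1 ?addr0 //.
by move=> u v def_s; apply: P0; rewrite // def_s.
Qed.

Lemma sum_splits_last (P : seq T * seq T -> V) s :
  (forall u v, s = u ++ v -> (0 < size v)%N -> P (u, v) = 0) ->
  \sum_(p <- splits s) P p = P (s, [::]).
Proof.
elim: s P => [|x s IHs] P P0; first by rewrite sum_splits0.
rewrite sum_splits_cons P0 // add0r (IHs (fun p => P (x :: p.1, p.2))) //.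
by move=> u v def_s; apply: P0; rewrite def_s.
Qed.

Lemma sum_splitsA (P : seq T -> seq T -> seq T -> V) s :
  \sum_(p <- splits s) \sum_(q <- splits p.2) P p.1 q.1 q.2 =
  \sum_(p <- splits s) \sum_(q <- splits p.1) P q.1 q.2 p.2.
Proof.
elim: s P => [|x s IHs] P; first by rewrite !sum_splits0.
rewrite !sum_splits_cons /= sum_splits0 /=.
under [X in _ = _ + X]eq_bigr do rewrite sum_splits_cons.
by rewrite big_split /= -addrA; congr (_ + (_ + _));
  rewrite (IHs (fun u => P (x :: u))).
Qed.

Lemma sum_cuts_splits (P : seq T -> T -> seq T -> V) s :
  \sum_(p <- cuts s) P p.1.1 p.1.2 p.2 =
  \sum_(p <- splits s) if p.2 is c :: v then P p.1 c v else 0.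
Proof.
elim: s P => [|x s IHs] P; first by rewrite sum_splits0 sum_cuts0.
by rewrite sum_splits_cons sum_cuts_cons /= (IHs (fun u => P (x :: u))).
Qed.

(** The letter at the cut comes from one of the two shuffled words; this is
    [sum_shuffles_splits] sorted by the first letter of the right-hand part. *)
Lemma sum_shuffles_cuts (P : seq T -> T -> seq T -> V) s t :
  \sum_(w <- shuffles s t) \sum_(p <- cuts w) P p.1.1 p.1.2 p.2 =
  \sum_(p <- cuts s) \sum_(q <- splits t)
    \sum_(u <- shuffles p.1.1 q.1) \sum_(v <- shuffles p.2 q.2) P u p.1.2 v +
  \sum_(p <- cuts t) \sum_(q <- splits s)
    \sum_(u <- shuffles q.1 p.1.1) \sum_(v <- shuffles q.2 p.2) P u p.1.2 v.
Proof.
under eq_bigr do rewrite (sum_cuts_splits P).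
rewrite (sum_shuffles_splits (fun p => if p.2 is _ :: _ then _ else _)) /=.
rewrite (sum_cuts_splits (fun s1 c s2 => \sum_(q <- splits t)
  \sum_(u <- shuffles s1 q.1) \sum_(v <- shuffles s2 q.2) P u c v)).
rewrite (sum_cuts_splits (fun t1 c t2 => \sum_(q <- splits s)
  \sum_(u <- shuffles q.1 t1) \sum_(v <- shuffles q.2 t2) P u c v)).
have if_sum (X : seq T) (F : T -> seq T -> seq T * seq T -> V) r :
    (if X is c :: v then \sum_(q <- splits r) F c v q else 0) =
    \sum_(q <- splits r) if X is c :: v then F c v q else 0.
  by case: X => [|c v] //; rewrite big1.
under [X in _ = X + _]eq_bigr do rewrite if_sum.
under [X in _ = _ + X]eq_bigr do rewrite if_sum.
rewrite [X in _ = _ + X]exchange_big -big_split /=; apply: eq_bigr => p _.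
rewrite -big_split /=; apply: eq_bigr => q _.
case: p q => [p1 [|c p2]] [q1 [|d q2]] /=.
- by rewrite big1 ?addr0 // => u _; rewrite sum_shuffles_0s.
- by rewrite add0r; apply: eq_bigr => u _; rewrite !sum_shuffles_0s.
- by rewrite addr0; apply: eq_bigr => u _; rewrite !sum_shuffles_s0.
by rewrite -big_split /=; apply: eq_bigr => u _; rewrite sum_shuffles_cons.
Qed.

(** The letters of [t] that a shuffle puts before and after the marker [x]
    form a deconcatenation of [t]. *)
Lemma sum_shuffles_marker G x s1 s2 t :
  \sum_(w <- shuffles (s1 ++ x :: s2) t) G w =
  \sum_(q <- splits t) \sum_(u <- shuffles s1 q.1)
    \sum_(v <- shuffles s2 q.2) G (u ++ x :: v).
Proof.
elim: t s1 G => [|y t IHt] s1 G.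
  by rewrite sum_splits0 !sum_shuffles_s0.
elim: s1 G => [|z s1 IHs] G; rewrite [_ ++ _]/= sum_shuffles_cons.
  rewrite (IHt [::]) sum_splits_cons sum_shuffles_0s /=; congr (_ + _).
  by apply: eq_bigr => q _; rewrite !sum_shuffles_0s.
rewrite IHs (IHt (z :: s1)) !sum_splits_cons /= !sum_shuffles_s0.
rewrite -addrA -big_split /=; congr (_ + _).
by apply: eq_bigr => q _; rewrite sum_shuffles_cons.
Qed.

Lemma sum_cutsA (P : seq T -> T -> seq T -> T -> seq T -> V) s :
  \sum_(p <- cuts s) \sum_(q <- cuts p.1.1) P q.1.1 q.1.2 q.2 p.1.2 p.2 =
  \sum_(p <- cuts s) \sum_(q <- cuts p.2) P p.1.1 p.1.2 q.1.1 q.1.2 q.2.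
Proof.
elim: s P => [|x s IHs] P; first by rewrite !sum_cuts0.
rewrite !sum_cuts_cons /= sum_cuts0 add0r.
under eq_bigr do rewrite sum_cuts_cons.
by rewrite big_split /=; congr (_ + _); rewrite (IHs (fun u => P (x :: u))).
Qed.

Lemma sum_splits_cat (P : seq T -> seq T -> V) s t :
  \sum_(q <- splits (s ++ t)) P q.1 q.2 = P s t +
  \sum_(q <- cuts s) P q.1.1 (q.1.2 :: q.2 ++ t) +
  \sum_(q <- cuts t) P (s ++ rcons q.1.1 q.1.2) q.2.
Proof.
elim: s P => [|x s IHs] P.
  rewrite sum_cuts0 addr0 /=; elim: t P => [|y t IHt] P.
    by rewrite sum_splits0 sum_cuts0 addr0.
  by rewrite sum_splits_cons sum_cuts_cons /= (IHt (fun u => P (y :: u))).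
rewrite [_ ++ _]/= sum_splits_cons sum_cuts_cons /= (IHs (fun u => P (x :: u))).
ring.
Qed.

End ShuffleSums.

(** * Functions that vanish on shuffles *)

Section Alternal.
Variables (T : Type) (V : comNzRingType).
Implicit Types (s t : seq T) (L M N : seq T -> V).

(** Vanishing on proper shuffles characterises, by Ree's theorem, the
    coefficients of Lie series; the name is that of mould calculus. *)
Definition alternal L : Prop := forall s t, (0 < size s)%N -> (0 < size t)%N ->
  \sum_(w <- shuffles s t) L w = 0.

(** As deconcatenation is multiplicative, only M(s) N(t) + M(t) N(s) survives
    of the product of M and N on the shuffles of s and t, and this is symmetric
    in M and N. *)
Lemma alternal_commutator M N : alternal M -> alternal N ->
  M [::] = 0 -> N [::] = 0 ->
  alternal (fun w => \sum_(p <- splits w) (M p.1 * N p.2 - N p.1 * M p.2)).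
Proof.
have half L L' : alternal L -> alternal L' -> L [::] = 0 -> L' [::] = 0 ->
    forall s t, (0 < size s)%N -> (0 < size t)%N ->
    \sum_(w <- shuffles s t) \sum_(p <- splits w) L p.1 * L' p.2 =
    L t * L' s + L s * L' t.
  move=> altL altL' L0 L'0 [//|x s] t _ t_gt0.
  rewrite (sum_shuffles_splits (fun p => L p.1 * L' p.2)) /=.
  under eq_bigr do under eq_bigr do rewrite -big_distrlr.
  rewrite sum_splits_cons /= sum_splits_last => [|u v _ v_gt0] /=; last first.
    by rewrite altL' ?mulr0.
  rewrite sum_shuffles_0s sum_shuffles_s0; congr (_ + _).
  transitivity (\sum_(p <- splits s) L (x :: p.1) *
      \sum_(w <- shuffles p.2 t) L' w).
    apply: eq_bigr => p _; rewrite sum_splits_first => [|u v _ u_gt0] /=.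
      by rewrite sum_shuffles_s0.
    by rewrite altL ?mul0r.
  rewrite sum_splits_last => [|u v _ v_gt0] /=.
    by rewrite sum_shuffles_0s.
  by rewrite altL' ?mulr0.
move=> altM altN M0 N0 s t s_gt0 t_gt0.
under eq_bigr do rewrite sumrB.
by rewrite sumrB !half //; ring.
Qed.

(** Let i(p) and j(p) mean that the word p is shuffled in to the left and to
    the right of the marker [x]. That L is alternal says that the convolution
    i * j vanishes on nonempty words, so j is a right inverse of i; the claim is
    that j is also a left inverse. Indeed i * (j * i) = (i * j) * i on t, and by
    induction on the length of t the claimed sum is the only term left when the
    common value i(t) is removed from both sides. *)
Lemma alternal_rotation L : alternal L -> forall x s1 s2 t, (0 < size t)%N ->
  \sum_(q <- splits t) \sum_(u <- shuffles s1 q.1)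
    \sum_(v <- shuffles s2 q.2) L (v ++ x :: u) = 0.
Proof.
move=> altL x s1 s2 t; have [n] := ubnP (size t).
elim: n t s1 s2 => [//|n IHn] t s1 s2 le_t_n t_gt0.
pose S a b c := \sum_(z <- shuffles s2 a) \sum_(v <- shuffles z c)
  \sum_(u <- shuffles s1 b) L (v ++ x :: u).
(* i * j * i evaluated at t, grouped in both ways: [a] and [c] go to the left
   of the marker, [b] to the right. *)
have := sum_splitsA S t.
case: t t_gt0 le_t_n => [//|y t] _ le_t_n.
rewrite sum_splits_cons.
rewrite [X in _ + X = _]sum_splits_last /= => [|u v def_t v_gt0]; last first.
  rewrite /S exchange_big big1 // => z _.
  rewrite -[RHS](IHn v s1 z) //; last first.
    move: le_t_n; rewrite /= def_t size_cat ltnS.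
    exact: leq_ltn_trans (leq_addl _ _).
  apply: eq_bigr => q _; exact: exchange_big.
rewrite sum_splits0 [X in _ = X -> _]sum_splits_first => [|u v _ u_gt0] /=;
  last first.
  rewrite /S; under eq_bigr do rewrite sum_shufflesAC.
  rewrite exchange_big big1 // => z _.
  by rewrite -[RHS](altL (z ++ x :: s1) u) ?size_cat ?addnS //
    sum_shuffles_marker.
rewrite sum_splits0 /S /= sum_shuffles_s0.
under [X in _ + X = _]eq_bigr do rewrite sum_shuffles_s0.
rewrite -[X in _ = X -> _]add0r => /addIr E; rewrite -[RHS]E.
apply: eq_bigr => q _.
by rewrite sum_shuffles_s0 exchange_big.
Qed.

(** Each summand cuts the cyclic word formed by [x] and [w] at one of its
    letters. The one cut at [x] is alternal by assumption. When two words are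
    shuffled, the summands cut at a given letter of one of them cancel by
    [alternal_rotation], because cutting there turns the other word around the
    marker [x]. *)
Lemma alternal_cyclic_sum (L : T -> seq T -> V) x :
  (forall c, alternal (L c)) ->
  alternal (fun w => \sum_(p <- cuts (x :: w)) L p.1.2 (p.2 ++ p.1.1)).
Proof.
move=> altL s t s_gt0 t_gt0.
under eq_bigr do rewrite sum_cuts_cons /= cats0.
rewrite big_split /= altL // add0r.
rewrite (sum_shuffles_cuts (fun u c v => L c (v ++ x :: u))).
rewrite !big1 ?addr0 // => p _; last exact: alternal_rotation.
rewrite -[RHS](alternal_rotation (altL p.1.2) x p.1.1 p.2 s_gt0).
apply: eq_bigr => q _; rewrite sum_shufflesC; apply: eq_bigr => u _.
exact: sum_shufflesC.
Qed.

End Alternal.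

Section ShuffleList.
Variables (T : eqType).
Implicit Types (s t w : seq T).

Lemma shuffles_perm s t w :
  w \in shuffles s t -> perm_eq w (s ++ t).
Proof.
elim: s t w => [|x s IHs] t w; first by rewrite inE => /eqP->.
elim: t w => [|y t IHt] w; first by rewrite shuffles_s0 inE cats0 => /eqP->.
rewrite shuffles_cons mem_cat => /orP[] /mapP[z z_in ->].
  by rewrite /= perm_cons IHs.
rewrite perm_sym (perm_catCA (x :: s) [:: y] t) /= perm_cons perm_sym.
exact: IHt.
Qed.

End ShuffleList.

(** * Gluing functions of sequences of points *)

Section Convolution.
Variables (T : Type) (K : comNzRingType).
Implicit Types (s t : seq T) (G H I N : seq T -> K).

(** A factorisation of a path shares the point at which the path is cut:
    these are entries of products of upper triangular matrices whose rows are
    indexed by the points. *)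
Definition conv G H s : K :=
  \sum_(p <- cuts s) G (rcons p.1.1 p.1.2) * H (p.1.2 :: p.2).

Definition bracket G H s : K := conv G H s - conv H G s.

(** Replacing one step of a path, from p to q, by a longer path with the same
    ends and weight N; by [detour_conv] this is a derivation for [conv]. *)
Definition detour N G s : K :=
  \sum_(p <- cuts s) \sum_(q <- cuts p.2)
    N (p.1.2 :: rcons q.1.1 q.1.2) * G (p.1.1 ++ p.1.2 :: q.1.2 :: q.2).

Lemma conv0 G H : conv G H [::] = 0.
Proof. exact: sum_cuts0. Qed.

Lemma conv_cons G H x s :
  conv G H (x :: s) = G [:: x] * H (x :: s) + conv (fun u => G (x :: u)) H s.
Proof. by rewrite /conv sum_cuts_cons. Qed.

Lemma detour0 N G : detour N G [::] = 0.
Proof. exact: sum_cuts0. Qed.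

Lemma detour_cons N G x s : detour N G (x :: s) =
  conv (fun u => N (x :: u)) (fun u => G (x :: u)) s +
  detour N (fun u => G (x :: u)) s.
Proof. by rewrite /detour sum_cuts_cons. Qed.

Lemma convDl G G' H s :
  conv (fun u => G u + G' u) H s = conv G H s + conv G' H s.
Proof. by rewrite -big_split; apply: eq_bigr => p _; rewrite mulrDl. Qed.

Lemma convDr G H H' s :
  conv G (fun u => H u + H' u) s = conv G H s + conv G H' s.
Proof. by rewrite -big_split; apply: eq_bigr => p _; rewrite mulrDr. Qed.

Lemma convBl G G' H s :
  conv (fun u => G u - G' u) H s = conv G H s - conv G' H s.
Proof. by rewrite -sumrB; apply: eq_bigr => p _; rewrite mulrBl. Qed.

Lemma convBr G H H' s :
  conv G (fun u => H u - H' u) s = conv G H s - conv G H' s.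
Proof. by rewrite -sumrB; apply: eq_bigr => p _; rewrite mulrBr. Qed.

Lemma convZl a G H s : conv (fun u => a * G u) H s = a * conv G H s.
Proof. by rewrite [RHS]big_distrr; apply: eq_bigr => p _ /=; rewrite mulrA. Qed.

Lemma convZr a G H s : conv G (fun u => a * H u) s = a * conv G H s.
Proof.
by rewrite [RHS]big_distrr; apply: eq_bigr => p _ /=; rewrite mulrCA.
Qed.

Lemma detourD N G H s :
  detour N (fun u => G u + H u) s = detour N G s + detour N H s.
Proof.
rewrite -big_split; apply: eq_bigr => p _; rewrite -big_split.
by apply: eq_bigr => q _; rewrite mulrDr.
Qed.

Lemma detourB N G H s :
  detour N (fun u => G u - H u) s = detour N G s - detour N H s.
Proof.
rewrite -sumrB; apply: eq_bigr => p _; rewrite -sumrB.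
by apply: eq_bigr => q _; rewrite mulrBr.
Qed.

Lemma detourZ N a G s : detour N (fun u => a * G u) s = a * detour N G s.
Proof.
rewrite [RHS]big_distrr; apply: eq_bigr => p _; rewrite [RHS]big_distrr.
by apply: eq_bigr => q _; rewrite /= mulrCA.
Qed.

Lemma eq_conv G G' H H' s :
  (forall u c v, s = u ++ c :: v -> G (rcons u c) = G' (rcons u c)) ->
  (forall u c v, s = u ++ c :: v -> H (c :: v) = H' (c :: v)) ->
  conv G H s = conv G' H' s.
Proof.
move=> eqG eqH; apply: eq_sum_cuts => u c v def_s /=.
by rewrite (eqG _ _ _ def_s) (eqH _ _ _ def_s).
Qed.

Lemma convA G H I s :
  conv (fun u => conv G H u) I s = conv G (fun u => conv H I u) s.
Proof.
elim: s G => [|x s IHs] G; first by rewrite !conv0.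
rewrite !conv_cons conv0 addr0.
transitivity (G [:: x] * H [:: x] * I (x :: s) + conv (fun u =>
    G [:: x] * H (x :: u) + conv (fun v => G (x :: v)) H u) I s).
  by congr (_ + _); apply: eq_conv => // u c v _; rewrite conv_cons.
by rewrite convDl convZl IHs mulrDr; ring.
Qed.

(** A step of a path lies before or after the point where the path is cut. *)
Lemma detour_conv N G H s : detour N (fun u => conv G H u) s =
  conv (fun u => detour N G u) H s + conv G (fun u => detour N H u) s.
Proof.
elim: s G => [|x s IHs] G; first by rewrite detour0 !conv0 addr0.
rewrite detour_cons !conv_cons detour_cons detour0 conv0 detour_cons.
have convE u : conv G H (x :: u) =
    G [:: x] * H (x :: u) + conv (fun v => G (x :: v)) H u.
  exact: conv_cons.
have detE u : detour N G (x :: u) =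
    conv (fun v => N (x :: v)) (fun v => G (x :: v)) u +
    detour N (fun v => G (x :: v)) u.
  exact: detour_cons.
transitivity (conv (fun u => N (x :: u)) (fun u => G [:: x] * H (x :: u) +
    conv (fun v => G (x :: v)) H u) s +
  detour N (fun u => G [:: x] * H (x :: u) + conv (fun v => G (x :: v)) H u) s).
  by congr (_ + _); [apply: eq_conv => // | apply: eq_bigr => p _;
    apply: eq_bigr => q _; case: p.1.1 => [|y r]]; rewrite ?convE.
rewrite detourD detourZ IHs convDr convZr.
rewrite (@eq_conv (fun u => detour N G (x :: u)) (fun u =>
    conv (fun v => N (x :: v)) (fun v => G (x :: v)) u +
    detour N (fun v => G (x :: v)) u) H H) //.
rewrite convDl convA; ring.
Qed.

Lemma bracket_jacobi G H I s :
  bracket (fun u => bracket G H u) I s + bracket H (fun u => bracket G I u) s =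
  bracket G (fun u => bracket H I u) s.
Proof. by rewrite /bracket !convBl !convBr !convA; ring. Qed.

Lemma detour_bracket N G H s : detour N (fun u => bracket G H u) s =
  bracket (fun u => detour N G u) H s + bracket G (fun u => detour N H u) s.
Proof. by rewrite /bracket detourB !detour_conv; ring. Qed.

Lemma conv_singl G H s x :
  (forall c v, (0 < size v)%N -> H (c :: v) = 0) ->
  conv G H (rcons s x) = G (rcons s x) * H [:: x].
Proof.
move=> H0; elim: s G => [|y s IHs] G.
  by rewrite /= conv_cons conv0 addr0.
by rewrite /= conv_cons IHs H0 ?size_rcons // mulr0 add0r.
Qed.

Lemma conv_singr G H x s :
  (forall c v, (0 < size v)%N -> G (c :: v) = 0) ->
  conv G H (x :: s) = G [:: x] * H (x :: s).
Proof.
move=> G0; rewrite conv_cons /conv big1 ?addr0 // => p _.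
by rewrite G0 ?mul0r // size_rcons.
Qed.

End Convolution.

(** * Evaluation of words along a sequence of points *)

Section Evaluation.
Variables (K : fieldType) (emb : {rmorphism rat -> K}).
Implicit Types (xs s : seq K) (t u : tensor).

(** The entry, from the first point to the last, of the product of matrices
    that represents a word: [a] acts by the diagonal matrix of the points and
    [b] by the superdiagonal matrix with entries 1 / (x_i - x_(i+1)). With this
    scaling of [b], the element [a,b] acts by the shift matrix. *)
Fixpoint word_eval (w : seq bool) xs : K :=
  match w, xs with
  | [::], [:: x] => 1
  | l :: w', x :: xs' =>
      if l == letter_b then
        if xs' is y :: _ then (x - y)^-1 * word_eval w' xs' else 0
      else x * word_eval w' xs
  | _, _ => 0
  end.

Definition eval t xs : K := monalg.mmap emb (fun w : word => word_eval w xs) t.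

Lemma word_eval_nil w : word_eval w [::] = 0.
Proof. by case: w. Qed.

Lemma word_eval_cat w1 w2 xs :
  word_eval (w1 ++ w2) xs = conv (word_eval w1) (word_eval w2) xs.
Proof.
elim: w1 xs => [|l w1 IHw] [|x s]; rewrite ?conv0 ?word_eval_nil //.
  rewrite conv_cons mul1r /conv big1 ?addr0 // => p _.
  by case: p.1.1 => [|y r]; rewrite mul0r.
rewrite conv_cons /=; case: (l == letter_b); last first.
  by rewrite convZl IHw conv_cons; ring.
rewrite mul0r add0r; case: s => [|y s]; first by rewrite conv0.
rewrite IHw -convZl; apply: eq_conv => // -[|z u] c v [<-] //.
Qed.

Lemma eval_lin c t u xs :
  eval (c *: t + u) xs = emb c * eval t xs + eval u xs.
Proof.
rewrite /eval monalg.mmapD; congr (_ + _).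
rewrite (monalg.mmapEw (monalg.msuppZ_le _ _)) monalg.mmapE big_distrr /=.
by apply: eq_bigr => w _; rewrite monalg.mcoeffZ rmorphM mulrA.
Qed.

Lemma evalB t u xs : eval (t - u) xs = eval t xs - eval u xs.
Proof. by rewrite /eval monalg.mmapB. Qed.

Lemma evalD t u xs : eval (t + u) xs = eval t xs + eval u xs.
Proof. by rewrite /eval monalg.mmapD. Qed.

Lemma eval0 xs : eval 0 xs = 0.
Proof. by rewrite /eval monalg.mmap0. Qed.

Lemma eval_nil t : eval t [::] = 0.
Proof.
by rewrite /eval monalg.mmapE big1 // => w _; rewrite word_eval_nil mulr0.
Qed.

Lemma evalM t u xs : eval (t * u) xs = conv (eval t) (eval u) xs.
Proof.
rewrite monalg.malgME /eval raddf_sum /=.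
transitivity (\sum_(w1 <- words_of t) \sum_(w2 <- words_of u)
   emb (monalg.mcoeff w1 t) * emb (monalg.mcoeff w2 u) *
     conv (word_eval w1) (word_eval w2) xs).
  apply: eq_bigr => w1 _; rewrite raddf_sum /=; apply: eq_bigr => w2 _.
  rewrite monalg.mmapU /= rmorphM; congr (_ * _).
  by rewrite -word_eval_cat fmM.
rewrite /conv; under [RHS]eq_bigr do rewrite !monalg.mmapE big_distrlr /=.
rewrite [RHS]exchange_big; apply: eq_bigr => w1 _.
rewrite [RHS]exchange_big; apply: eq_bigr => w2 _.
by rewrite big_distrr; apply: eq_bigr => p _ /=; ring.
Qed.

Lemma eval_bracket t u xs :
  eval (tensor_bracket t u) xs = bracket (eval t) (eval u) xs.
Proof. by rewrite evalB; congr (_ - _); apply: evalM. Qed.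

Lemma eval_a xs : eval tensor_a xs = if xs is [:: x] then x else 0.
Proof.
rewrite /eval monalg.mmapU /= rmorph1 mul1r fmU.
by case: xs => [|x [|y s]] //=; rewrite ?mulr1 ?mulr0.
Qed.

Lemma eval_b xs : eval tensor_b xs = if xs is [:: x; y] then (x - y)^-1 else 0.
Proof.
rewrite /eval monalg.mmapU /= rmorph1 mul1r fmU.
by case: xs => [|x [|y [|z s]]] //=; rewrite ?mulr1 ?mulr0.
Qed.

Definition width xs : K := last 0 xs - head 0 xs.

(** The matrix of [a] is diagonal, so bracketing with it scales each entry. *)
Lemma bracket_eval_a G xs : bracket G (eval tensor_a) xs = width xs * G xs.
Proof.
have A0 c v : (0 < size v)%N -> eval tensor_a (c :: v) = 0.
  by rewrite eval_a; case: v.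
case: xs => [|x s]; first by rewrite /bracket !conv0 /width !subrr mul0r.
rewrite /bracket [conv (eval _) _ _]conv_singr // lastI conv_singl // -lastI.
by rewrite !eval_a /width /=; ring.
Qed.


End Evaluation.

(** * A derivation that kills [a,b], in terms of its value at a *)

Lemma lie_valD (h k : lie) : lie_val (h + k) = lie_val h + lie_val k.
Proof. exact: (raddfD (\val : lie -> tensor)). Qed.

Lemma lie_valB (h k : lie) : lie_val (h - k) = lie_val h - lie_val k.
Proof. exact: (raddfB (\val : lie -> tensor)). Qed.

Lemma lie_val0 : lie_val 0 = 0.
Proof. exact: (raddf0 (\val : lie -> tensor)). Qed.

Lemma lie_valZ c (h : lie) : lie_val (c *: h) = c *: lie_val h.
Proof. exact: (linearZZ (\val : lie -> tensor)). Qed.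

Lemma lie_val_bracket (h k : lie) :
  lie_val (lie_bracket h k) = tensor_bracket (lie_val h) (lie_val k).
Proof. by []. Qed.

Section Derivations.
Variables (K : fieldType) (emb : {rmorphism rat -> K}).
Implicit Types (xs s : seq K) (d : lie -> lie) (F G H N : seq K -> K).
Local Notation eval := (eval emb).

(** At distinct points, the matrix F with [F, a] = d(a). As [word_eval]
    divides by the product of the x_i - x_(i+1), the polynomial of d(a) is here
    divided by the product of all differences around the cycle x_0, ..., x_n, up
    to sign. *)
Definition der_eval d xs : K := eval (d lie_a) xs / width xs.

(** The commutator of the shift matrix with F: this is the value at [a,b] of
    the derivation d - [F, .] when d kills [a,b]. *)
Definition excess (F : seq K -> K) xs : K :=
  if xs is x :: s then F s - F (belast x s) else 0.

Lemma width_neq0 x y s : uniq (x :: y :: s) -> width (x :: y :: s) != 0.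
Proof.
rewrite /width subr_eq0 /= => /andP[xNys _].
by apply: contraNneq xNys => <-; rewrite mem_last.
Qed.

(** No word without the letter [b] occurs in d(a) or d(b). *)
Definition depth_positive d : Prop :=
  forall x, eval (d lie_a) [:: x] = 0 /\ eval (d lie_b) [:: x] = 0.

Lemma der_evalK d xs : depth_positive d -> uniq xs ->
  width xs * der_eval d xs = eval (d lie_a) xs.
Proof.
move=> d_pos; case: xs => [|x [|y s]] Us; last 1 first.
- by rewrite mulrCA divff ?mulr1 // width_neq0.
- by rewrite eval_nil /der_eval eval_nil mul0r mulr0.
by rewrite /der_eval (d_pos x).1 mul0r mulr0.
Qed.

Lemma eval_lie_lin c (h k : lie) xs :
  eval (c *: h + k) xs = emb c * eval h xs + eval k xs.
Proof. by rewrite lie_valD lie_valZ eval_lin. Qed.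

(** This is d([a,b]) = 0 in the form [d(a), b] = [d(b), a]. *)
Lemma Der_Theta_eval_ab d : Der_Theta d -> forall xs,
  bracket (eval (d lie_a)) (eval tensor_b) xs =
  width xs * eval (d lie_b) xs.
Proof.
have ev_bracket f b a g xs : tensor_bracket f b + tensor_bracket a g = 0 ->
    bracket (eval f) (eval b) xs = bracket (eval g) (eval a) xs.
  move=> /(congr1 (fun t => eval t xs)).
  have -> : eval (tensor_bracket f b + tensor_bracket a g) xs =
      bracket (eval f) (eval b) xs + bracket (eval a) (eval g) xs.
    by rewrite evalD; congr (_ + _); apply: eval_bracket.
  by rewrite eval0 => /eqP; rewrite addr_eq0 => /eqP ->; rewrite /bracket opprB.
case=> [[_ d_lie]] d_ab xs. rewrite -(bracket_eval_a emb).
apply: ev_bracket.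
have E : d (lie_bracket lie_a lie_b) = 0 by [].
move/(congr1 lie_val): E; rewrite d_lie lie_valD lie_val0. by [].
Qed.

Lemma conv_eval_b_l G x y s :
  conv (eval tensor_b) G (x :: y :: s) = (x - y)^-1 * G (y :: s).
Proof.
rewrite !conv_cons !eval_b mul0r add0r /conv big1 ?addr0 // => p _.
by rewrite eval_b; case: p.1.1 => [|z [|? ?]]; rewrite mul0r.
Qed.

Lemma conv_eval_b_r G s x y :
  conv G (eval tensor_b) (rcons (rcons s x) y) = G (rcons s x) * (x - y)^-1.
Proof.
elim: s G => [|z s IHs] G /=.
  by rewrite !conv_cons conv0 !eval_b mulr0 !addr0.
by rewrite conv_cons IHs eval_b; case: s {IHs} => [|? [|? ?]];
  rewrite mulr0 add0r.
Qed.

Lemma conv_eval_b_rcons G x m y :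
  conv G (eval tensor_b) (x :: rcons m y) = G (x :: m) * (last x m - y)^-1.
Proof. by rewrite -rcons_cons lastI conv_eval_b_r -lastI. Qed.

Lemma conv_eval_b_cons G x m y :
  conv (eval tensor_b) G (x :: rcons m y) =
  (x - head y m)^-1 * G (rcons m y).
Proof. by case: m => [|z m]; rewrite /= conv_eval_b_l. Qed.

Lemma detour_eval_a N xs : detour N (eval tensor_a) xs = 0.
Proof.
rewrite /detour big1 // => p _; rewrite big1 // => q _.
by rewrite eval_a; case: p.1.1 => [|? [|? ?]]; rewrite mulr0.
Qed.

Lemma detour_eval_b N x m y :
  detour N (eval tensor_b) (x :: rcons m y) = N (x :: rcons m y) * (x - y)^-1.
Proof.
rewrite detour_cons conv_singl => [|c [|? v]] //; last by rewrite eval_b.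
rewrite eval_b /detour big1 ?addr0 // => p _; rewrite big1 // => q _.
by rewrite eval_b; case: p.1.1 => [|? [|? ?]]; rewrite mulr0.
Qed.

Lemma eval_der_a d xs : depth_positive d -> uniq xs ->
  eval (d lie_a) xs = bracket (der_eval d) (eval tensor_a) xs.
Proof. by move=> d_pos Uxs; rewrite bracket_eval_a der_evalK. Qed.

(** As the points are distinct, [Der_Theta_eval_ab] can be divided by the
    width and determines d(b); what remains is an identity between fractions in
    four points, the first two and the last two. *)
Lemma eval_der_b d xs : Der_Theta d -> depth_positive d -> uniq xs ->
  eval (d lie_b) xs =
  bracket (der_eval d) (eval tensor_b) xs +
  detour (excess (der_eval d)) (eval tensor_b) xs.
Proof.
move=> d_Theta d_pos; case: xs => [|x s].
  by rewrite eval_nil detour0 /bracket !conv0 subr0 addr0.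
case: (lastP s) => [|m y] Us.
  rewrite (d_pos x).2 detour_cons detour0 /bracket conv0.
  by rewrite !conv_cons !conv0 mulrC !addr0 subrr.
have [Uz Uw] : uniq (rcons m y) /\ uniq (x :: m).
  by move: (Us); rewrite -rcons_cons rcons_uniq => /andP[_ ->] /=;
    move: Us => /andP[].
have := Der_Theta_eval_ab d_Theta (x :: rcons m y).
rewrite /bracket !conv_eval_b_rcons !conv_eval_b_cons detour_eval_b /excess.
rewrite belast_rcons -!(der_evalK d_pos) //.
have x_neq_y : x - y != 0.
  rewrite subr_eq0; apply: contraTneq Us => ->.
  by rewrite /= mem_rcons mem_head.
have x_neq_hd : x - head y m != 0.
  rewrite subr_eq0; apply: contraTneq Us => ->.
  by case: (m) => [|z r]; rewrite /= inE eqxx.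
have last_neq_y : last x m - y != 0.
  rewrite subr_eq0; apply: contraTneq Us => /esym y_last.
  by rewrite -rcons_cons rcons_uniq y_last mem_last.
have -> : width (rcons m y) = y - head y m.
  by case: (m) => [|z r] //; rewrite /width last_rcons.
rewrite [width (x :: rcons _ _)]/width [width (x :: m)]/width /= last_rcons.
move: (der_eval d (x :: m)) (der_eval d (rcons m y)) => P Q.
move: (eval (d lie_b) _) => g.
move: (last x m) (head y m) x_neq_hd last_neq_y => l h x_neq_h l_neq_y E.
have y_neq_x : y - x != 0 by rewrite -oppr_eq0 opprB.
apply: (mulfI y_neq_x); rewrite -E.
by field; rewrite x_neq_y x_neq_h l_neq_y.
Qed.

Lemma eq_detour N G G' xs :
  (forall s, uniq s -> G s = G' s) -> uniq xs ->
  detour N G xs = detour N G' xs.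
Proof.
move=> eqG Uxs; apply: eq_sum_cuts => u p r def_xs; apply: eq_sum_cuts => m q w.
move=> /= def_r; rewrite eqG //; apply: subseq_uniq Uxs.
rewrite def_xs def_r; apply: cat_subseq => //=; rewrite eqxx.
exact: suffix_subseq.
Qed.

Lemma eq_conv_uniq G G' H H' xs :
  (forall s, uniq s -> G s = G' s) -> (forall s, uniq s -> H s = H' s) ->
  uniq xs -> conv G H xs = conv G' H' xs.
Proof.
move=> eqG eqH Uxs; apply: eq_conv => u c v def_xs.
  by apply: eqG; move: Uxs; rewrite def_xs -cat_rcons cat_uniq => /andP[].
by apply: eqH; move: Uxs; rewrite def_xs cat_uniq => /and3P[].
Qed.

Lemma eq_bracket_uniq G G' H H' xs :
  (forall s, uniq s -> G s = G' s) -> (forall s, uniq s -> H s = H' s) ->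
  uniq xs -> bracket G H xs = bracket G' H' xs.
Proof. by move=> eqG eqH Uxs; congr (_ - _); apply: eq_conv_uniq. Qed.

(** Both sides are derivations along [eval]. On the right, the inner one
    already agrees with d at [a], and the other one kills [a]. *)
Lemma eval_der d (h : lie) xs : Der_Theta d -> depth_positive d -> uniq xs ->
  eval (d h) xs =
  bracket (der_eval d) (eval h) xs + detour (excess (der_eval d)) (eval h) xs.
Proof.
move=> d_Theta d_pos; case: h => t /= t_lie.
have /asboolP t_in := t_lie.
elim: t_in t_lie xs => {t} [||c x y x_in IHx y_in IHy|x y x_in IHx y_in IHy].
- move=> a_lie xs Uxs; rewrite detour_eval_a addr0 -eval_der_a //.
  by congr (eval (d _) xs); apply: val_inj.
- move=> b_lie xs Uxs; rewrite -eval_der_b //.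
  by congr (eval (d _) xs); apply: val_inj.
- move=> xy_lie xs Uxs.
  have x_lie : x \in lie_pred by apply/asboolP.
  have y_lie : y \in lie_pred by apply/asboolP.
  have -> : Lie xy_lie = c *: Lie x_lie + Lie y_lie.
    apply: val_inj; rewrite -[val _]/(lie_val _) -[RHS]/(lie_val _).
    by rewrite lie_valD lie_valZ.
  case: d_Theta => [[d_lin _] _]; rewrite d_lin eval_lie_lin IHx // IHy //=.
  have evE s : eval (c *: x + y) s = emb c * eval x s + eval y s.
    exact: eval_lin.
  rewrite (@eq_bracket_uniq (der_eval d) (der_eval d) (eval (c *: x + y))
    (fun s => emb c * eval x s + eval y s)) //.
  rewrite (@eq_detour _ (eval (c *: x + y))
    (fun s => emb c * eval x s + eval y s)) //.
  by rewrite detourD detourZ /bracket convDl convDr convZl convZr; ring.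
move=> xy_lie xs Uxs.
have x_lie : x \in lie_pred by apply/asboolP.
have y_lie : y \in lie_pred by apply/asboolP.
have -> : Lie xy_lie = lie_bracket (Lie x_lie) (Lie y_lie) by apply: val_inj.
case: d_Theta => [[_ d_lie] _]; rewrite d_lie lie_valD evalD.
rewrite !lie_val_bracket.
set F := der_eval d; set N := excess F.
transitivity (
  bracket (fun s => bracket F (eval x) s + detour N (eval x) s) (eval y) xs +
  bracket (eval x) (fun s => bracket F (eval y) s + detour N (eval y) s) xs).
  congr (_ + _); rewrite eval_bracket /=.
    by apply: eq_bracket_uniq => // s Us; apply: IHx.
  by apply: eq_bracket_uniq => // s Us; apply: IHy.
have evE s : eval (tensor_bracket x y) s = bracket (eval x) (eval y) s.
  exact: eval_bracket.
rewrite /= (@eq_bracket_uniq F F (eval (tensor_bracket x y))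
  (bracket (eval x) (eval y))) //.
rewrite (@eq_detour N (eval (tensor_bracket x y))
  (bracket (eval x) (eval y))) //.
rewrite detour_bracket -bracket_jacobi /bracket !convDl !convDr; ring.
Qed.

Lemma depth_positive_bracket d1 d2 : Der_Theta d1 -> depth_positive d1 ->
  Der_Theta d2 -> depth_positive d2 -> depth_positive (der_bracket d1 d2).
Proof.
move=> d1_Theta d1_pos d2_Theta d2_pos x.
have pos d (h : lie) : Der_Theta d -> depth_positive d ->
    eval (d h) [:: x] = 0.
  move=> d_Theta d_pos; rewrite eval_der // detour_cons detour0 /bracket.
  by rewrite !conv_cons !conv0 mulrC !addr0 subrr.
by split; rewrite /der_bracket lie_valB evalB !pos // subrr.
Qed.

(** A detour does not move the end points. *)
Lemma width_detour N G xs :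
  detour N (fun s => width s * G s) xs = width xs * detour N G xs.
Proof.
rewrite /detour big_distrr; apply: eq_sum_cuts => u p r /= def_xs.
rewrite big_distrr; apply: eq_sum_cuts => m q w /= def_r.
rewrite mulrCA; congr (_ * _); rewrite /width def_xs def_r.
by case: u def_xs => [|z u] _ /=; rewrite !last_cat /= ?last_cat.
Qed.

(** The inner parts contribute [F1, [F2, a]] - [F2, [F1, a]], which is
    [[F1, F2], a] by the Jacobi identity. Bracketing with [a] multiplies by the
    width, which is then cancelled. *)
Lemma der_eval_bracket d1 d2 xs : Der_Theta d1 -> depth_positive d1 ->
  Der_Theta d2 -> depth_positive d2 -> uniq xs ->
  der_eval (der_bracket d1 d2) xs =
  bracket (der_eval d1) (der_eval d2) xs +
  detour (excess (der_eval d1)) (der_eval d2) xs -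
  detour (excess (der_eval d2)) (der_eval d1) xs.
Proof.
move=> d1_Theta d1_pos d2_Theta d2_pos Uxs.
have d12_pos := depth_positive_bracket d1_Theta d1_pos d2_Theta d2_pos.
case: xs Uxs => [|x [|y s]] Uxs.
- by rewrite /der_eval eval_nil mul0r /bracket !conv0 !detour0 !subr0 addr0.
- rewrite /der_eval (d12_pos x).1 mul0r !detour_cons !detour0 /bracket.
  by rewrite !conv_cons !conv0 mulrC !addr0 !subrr.
apply: (mulfI (width_neq0 Uxs)); rewrite der_evalK //.
rewrite [der_bracket _ _ _]/(_ - _) lie_valB evalB !eval_der //.
set w := x :: y :: s in Uxs *.
have step d d' : depth_positive d' ->
    bracket (der_eval d) (eval (d' lie_a)) w +
    detour (excess (der_eval d)) (eval (d' lie_a)) w =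
    bracket (der_eval d) (fun s => bracket (der_eval d') (eval tensor_a) s) w +
    width w * detour (excess (der_eval d)) (der_eval d') w.
  move=> d'_pos; congr (_ + _).
    by apply: eq_bracket_uniq => // r Ur; rewrite eval_der_a.
  rewrite -width_detour; apply: eq_detour => // r Ur.
  by rewrite der_evalK.
have bracket_width :=
  bracket_eval_a emb (bracket (der_eval d1) (der_eval d2)) w.
by rewrite !step // -bracket_jacobi bracket_width; ring.
Qed.

End Derivations.

(** * Cyclic invariance and alternality in the points *)

Section CyclicSum.
Variables (K : fieldType).
Implicit Types (s u v : seq K) (M N : seq K -> K).

(** The cut of the word [p.2 ++ p.1.1] falls between the two parts, inside the
    first or inside the second. By cyclic invariance the values on the resulting
    two arcs of the circle of points are those on the right-hand side. *)
Lemma sum_rotations M N s :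
  (forall u v, M (u ++ v) = M (v ++ u)) ->
  (forall u v, N (u ++ v) = N (v ++ u)) ->
  \sum_(p <- cuts s) \sum_(q <- splits (p.2 ++ p.1.1))
    M (p.1.2 :: q.1) * N (p.1.2 :: q.2) =
  conv N M s +
  (\sum_(p <- cuts s) \sum_(q <- cuts p.2)
    N (rcons q.1.1 q.1.2) * M (p.1.1 ++ p.1.2 :: q.1.2 :: q.2) +
  \sum_(p <- cuts s) \sum_(q <- cuts p.2)
    M (p.1.2 :: q.1.1) * N (p.1.1 ++ p.1.2 :: q.1.2 :: q.2)).
Proof.
move=> cycM cycN.
under eq_bigr => p _.
  rewrite (sum_splits_cat (fun u v => M (p.1.2 :: u) * N (p.1.2 :: v))).
  over.
rewrite !big_split /= -addrA [X in _ + X]addrC; congr (_ + (_ + _)).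
- apply: eq_bigr => p _; rewrite mulrC; congr (_ * _).
  by rewrite -cats1 cycN.
- rewrite (sum_cutsA (fun a y m c v => M (c :: v ++ rcons a y) * N (c :: m))).
  apply: eq_bigr => p _; apply: eq_bigr => q _; rewrite mulrC; congr (_ * _).
    by rewrite -cats1 cycN.
  by rewrite -cat_cons cycM cat_rcons.
apply: eq_bigr => p _; apply: eq_bigr => q _; congr (_ * _).
by rewrite cycN.
Qed.

(** Every term of [der_eval_bracket] is a product of the values on two arcs
    that cover the circle of points and meet in exactly one of them; each such
    pair of arcs occurs once, with the sign given by which arc comes first. *)
Lemma bracket_detour_cyclic M N s :
  (forall u v, M (u ++ v) = M (v ++ u)) ->
  (forall u v, N (u ++ v) = N (v ++ u)) ->
  bracket N M s + detour (excess N) M s - detour (excess M) N s =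
  \sum_(p <- cuts s) \sum_(q <- splits (p.2 ++ p.1.1))
    (M (p.1.2 :: q.1) * N (p.1.2 :: q.2) -
     N (p.1.2 :: q.1) * M (p.1.2 :: q.2)).
Proof.
move=> cycM cycN.
under [RHS]eq_bigr do rewrite sumrB.
rewrite sumrB !sum_rotations //.
have detE F G : detour (excess F) G s =
  \sum_(p <- cuts s) \sum_(q <- cuts p.2)
    F (rcons q.1.1 q.1.2) * G (p.1.1 ++ p.1.2 :: q.1.2 :: q.2) -
  \sum_(p <- cuts s) \sum_(q <- cuts p.2)
    F (p.1.2 :: q.1.1) * G (p.1.1 ++ p.1.2 :: q.1.2 :: q.2).
  rewrite -sumrB; apply: eq_bigr => p _; rewrite -sumrB.
  by apply: eq_bigr => q _; rewrite /excess belast_rcons mulrBl.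
by rewrite !detE /bracket; ring.
Qed.

End CyclicSum.

Section GeometricDerivations.
Variables (K : fieldType) (emb : {rmorphism rat -> K}).
Implicit Types (xs s u v w : seq K) (d : lie -> lie).
Local Notation eval := (eval emb).
Local Notation der_eval := (der_eval emb).

(** [Der_Theta_eval_ab] on the closed path x, s, x, which has width 0. *)
Lemma der_eval_rot1 d x s : Der_Theta d ->
  der_eval d (rcons s x) = der_eval d (x :: s).
Proof.
move=> d_Theta; have := Der_Theta_eval_ab emb d_Theta (x :: rcons s x).
rewrite /bracket conv_eval_b_rcons conv_eval_b_cons.
rewrite [width _]/width /= last_rcons subrr mul0r => /eqP.
rewrite subr_eq0 => /eqP; rewrite /der_eval [width (x :: s)]/width /= => ->.
rewrite mulrC; congr (_^-1 * _).
by case: s => [|y s]; rewrite /width //= last_rcons.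
Qed.

Lemma der_eval_cyclic d u v : Der_Theta d ->
  der_eval d (u ++ v) = der_eval d (v ++ u).
Proof.
move=> d_Theta; elim: u v => [|x u IHu] v; first by rewrite cats0.
by rewrite -cat_rcons -IHu /= -der_eval_rot1 // rcons_cat.
Qed.

(** Points with repetitions are given the value 0, since [eval_der] needs
    distinct points; alternality then makes sense for all sequences. *)
Definition der_generic d xs : K := if uniq xs then der_eval d xs else 0.

(** The property carried through the generation of the Lie algebra of
    geometric derivations. The first point stays fixed while the others are
    shuffled. *)
Definition vertex_alternal d : Prop :=
  [/\ Der_Theta d, depth_positive emb d &
      forall c, alternal (fun w => der_generic d (c :: w))].

(** On distinct points the bracket is a cyclic sum of commutators of alternal
    functions, which is alternal by [alternal_cyclic_sum]. *)
Lemma vertex_alternal_bracket d1 d2 :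
  vertex_alternal d1 -> vertex_alternal d2 ->
  Der_Theta (der_bracket d1 d2) ->
  vertex_alternal (der_bracket d1 d2).
Proof.
case=> d1_Theta d1_pos d1_alt [d2_Theta d2_pos d2_alt] d12_Theta.
split=> //; first exact: depth_positive_bracket.
move=> c s t s_gt0 t_gt0.
case Ucst : (uniq (c :: s ++ t)); last first.
  rewrite big_seq big1 // => w /shuffles_perm w_perm; rewrite /der_generic.
  rewrite (perm_uniq (_ : perm_eq (c :: w) (c :: s ++ t))) ?Ucst //.
  by rewrite perm_cons.
(* The commutator at the cut point [z] of the circle of points. *)
pose L z v := \sum_(q <- splits v)
  (der_generic d2 (z :: q.1) * der_generic d1 (z :: q.2) -
   der_generic d1 (z :: q.1) * der_generic d2 (z :: q.2)).
have gen1 d z : depth_positive emb d -> der_generic d [:: z] = 0.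
  by move=> d_pos; rewrite /der_generic /= /der_eval (d_pos z).1 mul0r.
have altL z : alternal (L z).
  by apply: (alternal_commutator (M := fun q => der_generic d2 (z :: q))
    (N := fun q => der_generic d1 (z :: q))) => //; apply: gen1.
rewrite -[RHS](alternal_cyclic_sum c altL s_gt0 t_gt0).
apply: eq_big_seq => w /shuffles_perm w_perm.
have Ucw : uniq (c :: w).
  by rewrite (perm_uniq (_ : perm_eq _ (c :: s ++ t))) // perm_cons.
rewrite /der_generic Ucw der_eval_bracket //.
rewrite bracket_detour_cyclic; try by move=> u v; apply: der_eval_cyclic.
apply: eq_sum_cuts => u z v def_cw; apply: eq_sum_splits => q1 q2 /= def_vu.
have Uzq : uniq (z :: q1 ++ q2).
  rewrite -def_vu -cat_cons; rewrite def_cw in Ucw.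
  by rewrite -(uniq_catC u).
have /andP[] : uniq (z :: q1) && uniq (z :: q2).
  by rewrite /=; move: Uzq; rewrite /= mem_cat negb_or cat_uniq;
    case/andP=> /andP[-> ->] /and3P[-> _ ->].
by rewrite /der_generic => -> ->.
Qed.

End GeometricDerivations.

(** * Derivations that kill [a,b] are closed under brackets *)

Section Closure.
Implicit Types (d : lie -> lie).

Lemma lie_bracketDl h k l :
  lie_bracket (h + k) l = lie_bracket h l + lie_bracket k l.
Proof.
apply: val_inj; rewrite -[val _]/(lie_val _) -[RHS]/(lie_val _).
rewrite lie_valD !lie_val_bracket lie_valD /tensor_bracket mulrDl mulrDr.
by rewrite opprD addrACA.
Qed.

Lemma lie_bracketDr h k l :
  lie_bracket l (h + k) = lie_bracket l h + lie_bracket l k.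
Proof.
apply: val_inj; rewrite -[val _]/(lie_val _) -[RHS]/(lie_val _).
rewrite lie_valD !lie_val_bracket lie_valD /tensor_bracket mulrDl mulrDr.
by rewrite opprD addrACA.
Qed.

Lemma tensor_scalerAr (c : rat) (t u : tensor) : t * (c *: u) = c *: (t * u).
Proof.
apply/monalg.malgP => w.
apply: etrans (monalg.mcoeffMlw _ (finmap.fsubset_refl _)
  (monalg.msuppZ_le c u)) _.
rewrite monalg.mcoeffZ monalg.mcoeffMl [RHS]big_distrr.
apply: eq_bigr => w1 _; rewrite [RHS]big_distrr; apply: eq_bigr => w2 _ /=.
by rewrite monalg.mcoeffZ mulrCA mulrnAr.
Qed.

Lemma lie_bracketZl c h k : lie_bracket (c *: h) k = c *: lie_bracket h k.
Proof.
apply: val_inj; rewrite -[val _]/(lie_val _) -[RHS]/(lie_val _).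
rewrite lie_valZ !lie_val_bracket lie_valZ /tensor_bracket.
by rewrite tensor_scalerAr -scalerAl scalerBr.
Qed.

Lemma lie_bracketZr c h k : lie_bracket h (c *: k) = c *: lie_bracket h k.
Proof.
apply: val_inj; rewrite -[val _]/(lie_val _) -[RHS]/(lie_val _).
rewrite lie_valZ !lie_val_bracket lie_valZ /tensor_bracket.
by rewrite tensor_scalerAr -scalerAl scalerBr.
Qed.

Lemma lie_bracketBl h k l :
  lie_bracket (h - k) l = lie_bracket h l - lie_bracket k l.
Proof. by rewrite -[- k]scaleN1r lie_bracketDl lie_bracketZl scaleN1r. Qed.

Lemma lie_bracketBr h k l :
  lie_bracket l (h - k) = lie_bracket l h - lie_bracket l k.
Proof. by rewrite -[- k]scaleN1r lie_bracketDr lie_bracketZr scaleN1r. Qed.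

Lemma Der_Theta_lin c d1 d2 :
  Der_Theta d1 -> Der_Theta d2 -> Der_Theta (c *: d1 + d2).
Proof.
case=> [[lin1 lie1] ab1] [[lin2 lie2] ab2].
have E x : (c *: d1 + d2) x = c *: d1 x + d2 x by [].
split; [split|] => [a x y|x y|]; rewrite !E.
- rewrite lin1 lin2 !scalerDr !scalerA [c * a]mulrC -!scalerA.
  by rewrite addrACA.
- rewrite lie1 lie2 !lie_bracketDl !lie_bracketDr lie_bracketZl lie_bracketZr.
  by rewrite scalerDr addrACA.
by rewrite ab1 ab2 scaler0 addr0.
Qed.

Lemma Der_Theta_bracket d1 d2 :
  Der_Theta d1 -> Der_Theta d2 -> Der_Theta (der_bracket d1 d2).
Proof.
case=> [[lin1 lie1] ab1] [[lin2 lie2] ab2].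
have add1 x y : d1 (x + y) = d1 x + d1 y by rewrite -[x]scale1r lin1 !scale1r.
have add2 x y : d2 (x + y) = d2 x + d2 y by rewrite -[x]scale1r lin2 !scale1r.
have d10 : d1 0 = 0 by apply: (addrI (d1 0)); rewrite -add1 !addr0.
have d20 : d2 0 = 0 by apply: (addrI (d2 0)); rewrite -add2 !addr0.
split; [split|] => [a x y|x y|]; rewrite /der_bracket.
- by rewrite lin2 lin1 lin1 lin2 scalerBr opprD addrACA.
- rewrite lie2 lie1 add1 add2 !lie1 !lie2 lie_bracketBl lie_bracketBr.
  set A := lie_bracket (d1 (d2 x)) y; set E := lie_bracket (d2 (d1 x)) y.
  set D := lie_bracket x (d1 (d2 y)); set F := lie_bracket x (d2 (d1 y)).
  move: (lie_bracket (d2 x) (d1 y)) (lie_bracket (d1 x) (d2 y)) A E D F.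
  move=> B C A E D F; apply/eqP.
  rewrite subr_eq eq_sym addrACA [A - E + _]addrA.
  rewrite subrK [B + F]addrC [D - F + _]addrA subrK.
  by rewrite [D + B]addrC addrACA.
by rewrite ab1 ab2 d10 d20 subrr.
Qed.

End Closure.

(** * Lie elements as functions of the differences of the points *)

(** A product of two words is a single letter only if one of the two is empty,
    and then the words commute. *)
Lemma coeff_bracket_a (t u : tensor) :
  coeff (fmu letter_a) (tensor_bracket t u) = 0.
Proof.
apply/eqP; rewrite /coeff monalg.mcoeffB subr_eq0; apply/eqP.
apply: etrans (monalg.mcoeffMl t u _) (etrans _ (esym (monalg.mcoeffMr u t _))).
apply: eq_bigr => w1 _; apply: eq_bigr => w2 _.
rewrite mulrC; congr (_ *+ nat_of_bool _).
have mulE (v1 v2 : word) : (monalg.mmul v1 v2 == fmu letter_a) =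
    (v1 ++ v2 == [:: letter_a] :> seq bool).
  by rewrite fmP fmM fmU.
have long (s : seq bool) : size s != 1%N -> (s == [:: letter_a]) = false.
  by apply: contraNF => /eqP ->.
rewrite !mulE; case: (w1 : seq bool) (w2 : seq bool) => [|x1 s1] [|x2 s2];
  by rewrite ?cats0 // !long // size_cat /= addnS.
Qed.

Section LieElements.
Variables (K : fieldType) (emb : {rmorphism rat -> K}).
Implicit Types (x : K) (ys : seq K) (t : tensor) (G H phi : seq K -> K).
Local Notation eval := (eval emb).

(** The points with first point [x] and consecutive differences [ys]. *)
Definition partial_sums x ys := x :: scanl +%R x ys.

Lemma conv_partial_sums G H x ys :
  conv G H (partial_sums x ys) = \sum_(p <- splits ys)
    G (partial_sums x p.1) * H (partial_sums (x + \sum_(y <- p.1) y) p.2).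
Proof.
elim: ys x G => [|y ys IHys] x G.
  by rewrite sum_splits0 /conv sum_cuts_cons sum_cuts0 !big_nil !addr0.
rewrite /partial_sums conv_cons sum_splits_cons big_nil addr0 /=; congr (_ + _).
rewrite (IHys (x + y) (fun u => G (x :: u))); apply: eq_bigr => p _.
by rewrite big_cons addrA.
Qed.

(** A Lie element is translation invariant apart from its multiple of [a], and
    it is alternal in the differences of the points. The denominators of [eval]
    do not interfere: they are symmetric in the differences. *)
Definition lie_series (c : K) (t : tensor) phi : Prop :=
  [/\ alternal phi, phi [::] = 0 &
      forall x ys, eval t (partial_sums x ys) =
        phi ys + if ys is [::] then c * x else 0].

Lemma lie_seriesM c1 c2 t1 t2 phi1 phi2 x ys :
  lie_series c1 t1 phi1 -> lie_series c2 t2 phi2 ->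
  eval (t1 * t2) (partial_sums x ys) =
  \sum_(p <- splits ys) phi1 p.1 * phi2 p.2 + c1 * x * phi2 ys +
  c2 * (x + \sum_(y <- ys) y) * phi1 ys +
  (if ys is [::] then c1 * c2 * x * x else 0).
Proof.
case=> alt1 phi10 eval1 [alt2 phi20 eval2].
rewrite evalM conv_partial_sums.
under eq_bigr do rewrite eval1 eval2 mulrDr !mulrDl.
rewrite !big_split /= -!addrA; congr (_ + _).
rewrite sum_splits_first => [|[|? u] v _ _] //; last by rewrite mul0r.
congr (_ + _).
rewrite sum_splits_last => [|u [|? v] _ _] //; last by rewrite mulr0.
rewrite mulrC; congr (_ + _).
case: ys => [|y ys].
  by rewrite sum_splits0 big_nil addr0 /=; ring.
rewrite sum_splits_first => [|[|? u] v _ _] //; last by rewrite mul0r.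
by rewrite mulr0.
Qed.

Lemma alternal_sumM phi :
  alternal phi -> alternal (fun w => (\sum_(y <- w) y) * phi w).
Proof.
move=> alt_phi s t s_gt0 t_gt0.
transitivity ((\sum_(y <- s ++ t) y) * \sum_(w <- shuffles s t) phi w).
  rewrite [RHS]big_distrr; apply: eq_big_seq => w /shuffles_perm w_perm /=.
  by rewrite (perm_big _ w_perm).
by rewrite alt_phi // mulr0.
Qed.

(** In a bracket, the terms of [lie_seriesM] that involve the first point
    cancel. What remains is a commutator of alternal functions and alternal
    functions times the sum of the differences, which is symmetric. *)
Lemma lie_series_exists t : in_lie t ->
  exists phi, lie_series (emb (coeff (fmu letter_a) t)) t phi.
Proof.
elim=> {t} [||c t u _ [phi [altphi phi0 phiE]] _ [psi [altpsi psi0 psiE]]|].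
- exists (fun=> 0); split=> [s t _ _||x [|y ys]] //; first exact: big1.
    by rewrite eval_a /coeff monalg.mcoeffUU rmorph1 mul1r add0r.
  by rewrite eval_a /partial_sums addr0.
- exists (fun ys => if ys is [:: y] then (- y)^-1 else 0).
  split=> [s t s_gt0 t_gt0||x [|y [|z ys]]] //.
  + rewrite big_seq big1 // => w /shuffles_perm/perm_size.
    rewrite size_cat; case: w s t s_gt0 t_gt0 => [|y [|z w]] [|? ?] [|? ?] //=.
    by rewrite addnS.
  + rewrite eval_b /coeff monalg.mcoeffU (_ : _ == _ = false).
      by rewrite rmorph0 mul0r addr0.
    by rewrite fmP !fmU.
  + by rewrite eval_b /partial_sums addr0 /= opprD addrA subrr add0r.
  by rewrite eval_b /partial_sums addr0.
- exists (fun ys => emb c * phi ys + psi ys); split=> [s r s_gt0 r_gt0||x ys].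
  + by rewrite big_split -big_distrr /= altphi // altpsi // mulr0 addr0.
  + by rewrite phi0 psi0 mulr0 addr0.
  rewrite eval_lin phiE psiE /coeff monalg.mcoeffD monalg.mcoeffZ.
  rewrite rmorphD rmorphM.
  by case: ys => [|y ys]; ring.
move=> t u _ [phi seriesphi] _ [psi seriespsi].
move: (seriesphi) (seriespsi) => [altphi phi0 _] [altpsi psi0 _].
set a := emb _ in seriesphi; set b := emb _ in seriespsi.
exists (fun ys =>
  \sum_(p <- splits ys) (phi p.1 * psi p.2 - psi p.1 * phi p.2) +
  (b * ((\sum_(y <- ys) y) * phi ys) - a * ((\sum_(y <- ys) y) * psi ys))).
split=> [s r s_gt0 r_gt0||x ys].
- rewrite big_split sumrB -!big_distrr /= !alternal_sumM // !mulr0 subrr addr0.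
  exact: alternal_commutator.
- by rewrite sum_splits0 phi0 psi0; ring.
rewrite coeff_bracket_a rmorph0 mul0r evalB.
have tuE := lie_seriesM x ys seriesphi seriespsi.
have utE := lie_seriesM x ys seriespsi seriesphi.
apply: etrans (congr2 (fun p q => p - q) tuE utE) _.
by rewrite sumrB; case: ys {tuE utE} => [|y ys]; ring.
Qed.

End LieElements.

(** * Geometric derivations are alternal in the points *)

Section Geometric.
Variables (K : fieldType) (emb : {rmorphism rat -> K}).
Implicit Types (x : K) (xs : seq K) (d : lie -> lie).
Local Notation eval := (eval emb).

Lemma eval_lie t x : in_lie t ->
  eval t [:: x] = emb (coeff (fmu letter_a) t) * x.
Proof.
move=> /(lie_series_exists emb)[phi [_ phi0 /(_ x [::])]] ->.
by rewrite phi0 add0r.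
Qed.

Lemma eval_iter_ad_a k (h : lie) xs :
  eval (iter k (lie_bracket lie_a) h) xs = (- width xs) ^+ k * eval h xs.
Proof.
elim: k => [|k IHk]; first by rewrite mul1r.
rewrite iterS lie_val_bracket eval_bracket exprS -mulrA -IHk mulNr.
by rewrite -(bracket_eval_a emb) /bracket opprB.
Qed.

(** The value at [a] is concentrated in depth one, where there are no proper
    shuffles. For a Lie element such as the value at [b], the coefficient of [a]
    accounts for all of its depth zero part. *)
Lemma vertex_alternal_epsilon m d : is_epsilon m d -> vertex_alternal emb d.
Proof.
case=> d_Theta d_a d_b.
have eval_da xs : size xs != 2 -> eval (d lie_a) xs = 0.
  rewrite d_a eval_iter_ad_a eval_b; case: xs => [|x [|y [|z s]]] //= _;
  by rewrite mulr0.
split=> // [x|c s t s_gt0 t_gt0].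
  split; first exact: eval_da.
  by rewrite eval_lie ?d_b ?rmorph0 ?mul0r //; apply/asboolP/lie_valP.
rewrite big_seq big1 // => w /shuffles_perm/perm_size.
rewrite size_cat => w_size.
rewrite /der_generic /der_eval eval_da ?mul0r ?if_same //= w_size.
by case: s t s_gt0 t_gt0 {w_size} => [|? ?] [|? ?] //=; rewrite addnS.
Qed.

Lemma vertex_alternal_lin c d1 d2 :
  vertex_alternal emb d1 -> vertex_alternal emb d2 ->
  vertex_alternal emb (c *: d1 + d2).
Proof.
case=> d1_Theta d1_pos d1_alt [d2_Theta d2_pos d2_alt].
have evalE h xs : eval ((c *: d1 + d2) h) xs =
    emb c * eval (d1 h) xs + eval (d2 h) xs by exact: eval_lie_lin.
split; first exact: Der_Theta_lin.
  move=> x; rewrite !evalE (d1_pos x).1 (d1_pos x).2 (d2_pos x).1 (d2_pos x).2.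
  by rewrite mulr0 addr0.
move=> z s t s_gt0 t_gt0.
transitivity (\sum_(w <- shuffles s t)
    (emb c * der_generic emb d1 (z :: w) + der_generic emb d2 (z :: w))).
  apply: eq_bigr => w _; rewrite /der_generic /der_eval evalE.
  by case: ifP => _; ring.
by rewrite big_split -big_distrr /= d1_alt // d2_alt // mulr0 addr0.
Qed.

Theorem u_geom_vertex_alternal d : in_u_geom d -> vertex_alternal emb d.
Proof.
elim=> {d} [m d|c d1 d2 _ IH1 _ IH2|d1 d2 _ IH1 _ IH2].
- exact: vertex_alternal_epsilon.
- exact: vertex_alternal_lin.
apply: vertex_alternal_bracket => //.
by apply: Der_Theta_bracket; [case: IH1 | case: IH2].
Qed.

End Geometric.

(** * Shuffles as permutations *)

Section ShuffleList.
Variables (T : eqType).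
Implicit Types (s t w : seq T).

Lemma map_shuffles (T' : Type) (f : T -> T') s t :
  shuffles (map f s) (map f t) = map (map f) (shuffles s t).
Proof.
elim: s t => [|x s IHs] t //.
elim: t => [|y t IHt] //.
rewrite [map f _]/= [map f (y :: _)]/= !shuffles_cons map_cat -!map_comp.
congr (_ ++ _).
  by rewrite -[f y :: _]/(map f (y :: t)) IHs -map_comp.
by rewrite -[f x :: _]/(map f (x :: s)) IHt -map_comp.
Qed.

Lemma shuffles_uniq s t : uniq (s ++ t) -> uniq (shuffles s t).
Proof.
elim: s t => [|x s IHs] t //.
elim: t => [|y t IHt] // Ust; rewrite shuffles_cons cat_uniq.
have consI (z : T) : injective (cons z) by move=> u v [].
have Us : uniq (shuffles s (y :: t)) by apply: IHs; move: Ust => /andP[].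
have Ut : uniq (shuffles (x :: s) t).
  by apply: IHt; apply: subseq_uniq Ust; apply: cat_subseq => //;
    exact: subseq_cons.
rewrite !map_inj_uniq // Us Ut andbT /=.
apply/hasPn => w /mapP[u _ ->]; apply/mapP => -[v _ [y_x _]].
by move: Ust; rewrite /= y_x mem_cat mem_head orbT.
Qed.

Lemma shuffles_subseq s t w :
  w \in shuffles s t -> subseq s w && subseq t w.
Proof.
elim: s t w => [|x s IHs] t w.
  by rewrite inE => /eqP->; rewrite sub0seq subseq_refl.
elim: t w => [|y t IHt] w.
  by rewrite shuffles_s0 inE => /eqP->; rewrite sub0seq subseq_refl.
rewrite shuffles_cons mem_cat => /orP[] /mapP[z z_in ->].
  have /andP[sub_s sub_t] := IHs _ _ z_in.
  apply/andP; split; first by rewrite /= eqxx.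
  exact: subseq_trans sub_t (subseq_cons z x).
have /andP[sub_s sub_t] := IHt _ z_in.
apply/andP; split; last by rewrite /= eqxx.
exact: subseq_trans sub_s (subseq_cons z y).
Qed.

(** The first letter of [w] is the first letter of [s] or of [t]: it occurs in
    one of them and, by uniqueness, nowhere in the rest of [w]. *)
Lemma mem_shuffles s t w : uniq (s ++ t) -> perm_eq w (s ++ t) ->
  (w \in shuffles s t) = subseq s w && subseq t w.
Proof.
move=> Ust w_perm; apply/idP/idP => [|/andP[]]; first exact: shuffles_subseq.
elim: w s t Ust w_perm => [|z w IHw] s t Ust w_perm.
  by move/perm_size: w_perm; case: s {Ust} => //=; case: t.
case: s Ust w_perm => [|x s] Ust w_perm.
  move=> _ sub_t; rewrite inE eq_sym -(size_subseq_leqif sub_t).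
  by rewrite (perm_size w_perm).
case: t Ust w_perm => [|y t] Ust w_perm.
  move=> sub_s _; rewrite shuffles_s0 inE eq_sym -(size_subseq_leqif sub_s).
  by rewrite (perm_size w_perm) cats0.
have Uw : uniq (z :: w) by rewrite (perm_uniq w_perm).
rewrite shuffles_cons mem_cat ![subseq _ (_ :: _)]/=.
have [x_z|x_z] := eqVneq x z.
  move: Ust w_perm; rewrite x_z /= perm_cons => /andP[z_st Ust] w_perm.
  have /negPf-> : y != z.
    by apply: contraNneq z_st => ->; rewrite mem_cat mem_head orbT.
  by move=> sub_s sub_t; rewrite map_f ?IHw.
have [y_z|y_z] := eqVneq y z.
  have := w_perm; rewrite y_z perm_sym (perm_catCA (x :: s) [:: z] t) /=.
  rewrite perm_cons perm_sym => w_perm' sub_s sub_t.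
  rewrite orbC map_f // IHw //.
  by rewrite -(perm_uniq w_perm'); case/andP: Uw.
move=> sub_s sub_t; have := mem_head z w.
rewrite (perm_mem w_perm) mem_cat => z_st; case/andP: Uw => /negP[].
by case/orP: z_st => [/(mem_subseq sub_s)|/(mem_subseq sub_t)].
Qed.

Lemma subseq_uniq_index s w : uniq w -> {subset s <= w} ->
  subseq s w = pairwise (fun x y => index x w < index y w)%N s.
Proof.
move=> Uw sub_sw; set R := fun x y => (index x w < index y w)%N.
have R_tr : transitive R by move=> y x z; apply: ltn_trans.
have R_w : pairwise R w.
  case: w @R Uw {R_tr sub_sw} => // z w R Uw.
  apply/(pairwiseP z) => i j i_w j_w ij.
  by rewrite /R !index_uniq.
apply/idP/idP => [sub_s|R_s].
  rewrite -sorted_pairwise // (subseq_sorted R_tr sub_s) //.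
  exact: pairwise_sorted.
have Us : uniq s.
  by rewrite (pairwise_uniq _ R_s) // => x; rewrite /R ltnn.
suffices -> : s = filter (mem s) w by exact: filter_subseq.
apply: (irr_sorted_eq R_tr) => [x|||x].
- by rewrite /R ltnn.
- exact: pairwise_sorted.
- exact/pairwise_sorted/pairwise_filter.
rewrite mem_filter; apply/idP/andP => [x_s|[]//].
by split=> //; apply: sub_sw.
Qed.

End ShuffleList.

Section ShufflePerm.
Variables (n : nat) (V : comNzRingType).

Definition perm_word (s : 'S_n) : seq 'I_n := [seq s i | i <- enum 'I_n].

Lemma index_perm_word (s : 'S_n) i : index i (perm_word s) = (s^-1)%g i.
Proof.
rewrite -[i in LHS](permKV s) index_map; last exact: perm_inj.
exact: index_enum_ord.
Qed.

Lemma perm_word_perm (s : 'S_n) : perm_eq (perm_word s) (enum 'I_n).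
Proof.
apply: uniq_perm => [||i]; last first.
- by rewrite mem_enum -[i](permKV s) map_f ?mem_enum.
- exact: enum_uniq.
by rewrite map_inj_uniq ?enum_uniq //; apply: perm_inj.
Qed.

Lemma perm_word_onto w : perm_eq w (enum 'I_n) -> exists s, w = perm_word s.
Proof.
move=> w_perm.
have size_w : size w = n by rewrite (perm_size w_perm) size_enum_ord.
have Uw : uniq w by rewrite (perm_uniq w_perm) enum_uniq.
have nth_inj : injective (fun i : 'I_n => nth i w i).
  move=> i j; rewrite (set_nth_default i j) ?size_w // => /eqP.
  by rewrite nth_uniq ?size_w // => /eqP/val_inj.
exists (perm nth_inj); rewrite /perm_word (eq_map (permE _)).
case: w size_w {w_perm Uw nth_inj} => [|z w] size_w.
  by rewrite [enum _]size0nil // size_enum_ord -size_w.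
rewrite (eq_map (g := nth z (z :: w) \o val)) => [|i]; last first.
  by apply: set_nth_default; rewrite size_w.
by rewrite map_comp val_enum_ord map_nth_iota0 ?take_oversize ?size_w.
Qed.

Lemma pairwise_enum_sub (R : rel 'I_n) (l : seq 'I_n) : subseq l (enum 'I_n) ->
  pairwise R l = [forall i in l, forall j in l, (i < j)%N ==> R i j].
Proof.
move=> sub_l.
have lt_tr : transitive (fun i j : 'I_n => (i < j)%N).
  by move=> j i k; apply: ltn_trans.
have l_lt : pairwise (fun i j : 'I_n => (i < j)%N) l.
  rewrite -sorted_pairwise //; apply: (subseq_sorted lt_tr sub_l).
  apply: pairwise_sorted; rewrite -(pairwise_map val ltn) val_enum_ord.
  by rewrite -sorted_pairwise ?iota_ltn_sorted //; apply: ltn_trans.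
apply/idP/forall_inP => [R_l i i_l|R_l].
  apply/forall_inP => j j_l; apply/implyP => lt_ij.
  have lt_idx : (index i l < index j l)%N.
    case: ltngtP => // [lt_ji|eq_idx]; last first.
      have eq_ij : i = j by rewrite -(nth_index i i_l) eq_idx nth_index.
      by rewrite eq_ij ltnn in lt_ij.
    have := pairwiseP i l_lt _ _ _ _ lt_ji.
    by rewrite !inE !index_mem !nth_index // ltnNge ltnW //; auto.
  have := pairwiseP i R_l _ _ _ _ lt_idx.
  by rewrite !inE !index_mem !nth_index //; auto.
apply: (sub_in_pairwise (P := mem l) _ _ l_lt); last exact/allP.
move=> i j i_l j_l lt_ij.
by move/forall_inP: (R_l i i_l) => /(_ j j_l); rewrite lt_ij.
Qed.

Lemma mem_take_enum k i : (i \in take k (enum 'I_n)) = (i < k)%N.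
Proof. by rewrite in_take ?mem_enum // index_enum_ord. Qed.

Lemma mem_drop_enum k i : (i \in drop k (enum 'I_n)) = (k <= i)%N.
Proof.
rewrite leqNgt -mem_take_enum.
have : i \in take k (enum 'I_n) ++ drop k (enum 'I_n).
  by rewrite cat_take_drop mem_enum.
have : uniq (take k (enum 'I_n) ++ drop k (enum 'I_n)).
  by rewrite cat_take_drop enum_uniq.
rewrite cat_uniq mem_cat => /and3P[_ no_i _].
have [i_take _|//] := boolP (i \in take k _).
by apply: contraNF no_i => i_drop; apply/hasP; exists i.
Qed.

End ShufflePerm.

(** A permutation is a shuffle exactly when both blocks are subsequences of
    its word. *)
Lemma sum_shuffle_perm (V : comNzRingType) d k (G : seq 'I_d.+1 -> V) :
  \sum_(s : 'S_d.+1 | is_shuffle k s) G (perm_word s) =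
  \sum_(w <- shuffles (take k (enum 'I_d.+1)) (drop k (enum 'I_d.+1))) G w.
Proof.
have U : uniq (take k (enum 'I_d.+1) ++ drop k (enum 'I_d.+1)).
  by rewrite cat_take_drop enum_uniq.
rewrite -big_filter -(big_map (@perm_word d.+1) xpredT G) /=.
apply: perm_big; apply: uniq_perm; last move=> w.
- rewrite map_inj_uniq ?filter_uniq ?index_enum_uniq // => s1 s2 eq_s.
  apply/permP => i; apply/eqP.
  by move/eq_in_map: eq_s => -> //; rewrite mem_enum.
- exact: shuffles_uniq.
pose cond (s : 'S_d.+1) (l : seq 'I_d.+1) := [forall i in l, forall j in l,
  (i < j)%N ==> (index i (perm_word s) < index j (perm_word s))%N].
have subseq_cond s l : subseq l (enum 'I_d.+1) ->
    subseq l (perm_word s) = cond s l.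
  move=> sub_l; rewrite subseq_uniq_index ?(perm_uniq (perm_word_perm s)) //.
  - by rewrite pairwise_enum_sub.
  - exact: enum_uniq.
  by move=> i _; rewrite (perm_mem (perm_word_perm s)) mem_enum.
have shuffleE s : is_shuffle k s = (perm_word s \in
    shuffles (take k (enum 'I_d.+1)) (drop k (enum 'I_d.+1))).
  rewrite mem_shuffles ?cat_take_drop ?perm_word_perm ?enum_uniq //.
  rewrite !subseq_cond ?take_subseq ?drop_subseq //.
  apply/forallP/andP => [sh|[/forall_inP sh_take /forall_inP sh_drop] i].
    split; apply/forall_inP => i i_in; apply/forall_inP => j j_in;
      apply/implyP => lt_ij; rewrite !index_perm_word;
      apply: (implyP (forallP (sh i) j));
      rewrite lt_ij /=.
      by move: i_in j_in; rewrite !mem_take_enum => -> ->.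
    by move: i_in j_in; rewrite !mem_drop_enum !ltnNge => -> ->.
  apply/forallP => j; apply/implyP => /andP[lt_ij /eqP same].
  rewrite -!index_perm_word; have [lt_ik|le_ki] := ltnP i k.
    have lt_jk : (j < k)%N by rewrite -same.
    have /forall_inP/(_ j) := sh_take i (etrans (mem_take_enum _ _) lt_ik).
    by rewrite mem_take_enum lt_jk lt_ij; apply.
  have le_kj : (k <= j)%N by rewrite leqNgt -same -leqNgt.
  have /forall_inP/(_ j) := sh_drop i (etrans (mem_drop_enum _ _) le_ki).
  by rewrite mem_drop_enum le_kj lt_ij; apply.
apply/mapP/idP => [[s]|w_in].
  by rewrite mem_filter => /andP[s_sh _] ->; rewrite -shuffleE.
have [s def_w] : exists s, w = perm_word s.
  apply: perm_word_onto.
  by rewrite -(cat_take_drop k (enum 'I_d.+1)) shuffles_perm.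
by exists s; rewrite // mem_filter mem_index_enum shuffleE -def_w w_in.
Qed.

(** * Substitutions in rational functions *)

Lemma fraction_repr (R : idomainType) (f : {fraction R}) :
  f = (\n_(generic_quotient.repr f))%:F / (\d_(generic_quotient.repr f))%:F.
Proof.
set x := generic_quotient.repr f.
have d0 : \d_x != 0 by exact: denom_ratioP.
have dF0 : (\d_x)%:F != 0 by rewrite tofrac_eq0.
apply: (mulIf dF0); rewrite divfK // -[f]generic_quotient.reprK -/x.
unlock FracField.tofrac; rewrite -[LHS]FracField.pi_mul.
apply/generic_quotient.eqmodP; rewrite /= FracField.equivfE /FracField.mulf.
by rewrite !numden_Ratio ?mulf_neq0 ?oner_neq0 // !mulr1 mulrC.
Qed.

Section Monomials.
Variables (K : fieldType).
Implicit Types (x : K) (xs : seq K).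

Fixpoint edges xs : K :=
  if xs is x :: (y :: _) as xs' then (x - y) * edges xs' else 1.

Lemma exponents_neq0 w :
  exponents w = head 0%N (exponents w) :: behead (exponents w).
Proof. by elim: w => [|[] w IHw] //=; rewrite IHw. Qed.

Lemma word_evalE w xs : size xs = (count_mem letter_b w).+1 ->
  word_eval w xs = (\prod_(p <- zip xs (exponents w)) p.1 ^+ p.2) / edges xs.
Proof.
elim: w xs => [|l w IHw] [|x xs] //=.
  by case: xs => // _; rewrite big_seq1 divr1.
case: l => /= [|size_xs]; last first.
  rewrite IHw //= exponents_neq0 /= !big_cons /= exprS; ring.
rewrite add1n => -[]; case: xs => // y xs size_xs.
by rewrite IHw // big_cons expr0 mul1r invfM; ring.
Qed.

Lemma word_eval_size w xs : size xs != (count_mem letter_b w).+1 ->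
  word_eval w xs = 0.
Proof.
elim: w xs => [|l w IHw] [|x xs] //=; first by case: xs.
case: l => /= [|size_xs]; last by rewrite IHw ?mulr0.
by case: xs => // y xs size_xs; rewrite IHw ?mulr0.
Qed.

Lemma edges_cons x y xs : edges (x :: y :: xs) = (x - y) * edges (y :: xs).
Proof. by []. Qed.

End Monomials.

Arguments edges : simpl never.

Section Substitution.
Variable d : nat.
Implicit Types (p q : polynom d) (z : 'I_d.+1 -> polynom d).

Definition msubst z p : polynom d := p \mPo [tuple z i | i < d.+1].

HB.instance Definition _ z :=
  GRing.RMorphism.copy (msubst z) (comp_mpoly [tuple z i | i < d.+1]).

Lemma msubstC z c : msubst z c%:MP = c%:MP.
Proof. exact: comp_mpolyC. Qed.

Lemma msubstX z i : msubst z 'X_i = z i.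
Proof. by rewrite /msubst comp_mpolyXU -tnth_nth tnth_mktuple. Qed.

Lemma msubst_comp z z' p :
  msubst z' (msubst z p) = msubst (fun i => msubst z' (z i)) p.
Proof.
rewrite /msubst [p \mPo _ in LHS]comp_mpolyE [RHS]comp_mpolyE raddf_sum /=.
apply: eq_bigr => m _; rewrite comp_mpolyZ rmorph_prod /=; congr (_ *: _).
by apply: eq_bigr => i _; rewrite rmorphXn /= !tnth_mktuple.
Qed.

Lemma msubst_id p : msubst (fun i => 'X_i) p = p.
Proof. exact: comp_mpoly_id. Qed.

(** Guarantees that no denominator is killed by the substitution, so that
    [ratfun_subst] does not depend on the representative of the fraction. *)
Definition invertible z := exists z', forall i, msubst z' (z i) = 'X_i.

Lemma msubstK z z' p : (forall i, msubst z' (z i) = 'X_i) ->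
  msubst z' (msubst z p) = p.
Proof.
move=> z'K; rewrite msubst_comp -[RHS]msubst_id; congr (_ \mPo _).
by apply: eq_mktuple => i; rewrite z'K.
Qed.

Lemma invertible_comp z z' : invertible z -> invertible z' ->
  invertible (fun i => msubst z' (z i)).
Proof.
case=> y yK [y' y'K]; exists (fun i => msubst y (y' i)) => i.
by rewrite -msubst_comp (msubstK _ y'K) yK.
Qed.

Lemma msubst_eq0 z p : invertible z -> (msubst z p == 0) = (p == 0).
Proof.
case=> z' z'K; apply/eqP/eqP => [p0|->]; last exact: raddf0.
by rewrite -(msubstK p z'K) p0 (raddf0 (msubst z')).
Qed.

Lemma ratfun_substE p q z : q != 0 -> invertible z ->
  ratfun_subst (p%:F / q%:F) z = (msubst z p)%:F / (msubst z q)%:F.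
Proof.
move=> q0 z_inv; rewrite /ratfun_subst; set f := p%:F / q%:F.
have := fraction_repr f; set r := generic_quotient.repr f => fE.
have d0 : \d_r != 0 by exact: denom_ratioP.
have num_eq : p * \d_r = \n_r * q.
  apply/eqP; rewrite -tofrac_eq !tofracM -eqr_div ?tofrac_eq0 //.
  by rewrite -fE.
apply/eqP; rewrite eq_sym eqr_div ?tofrac_eq0 ?msubst_eq0 //.
by rewrite -!tofracM tofrac_eq -!rmorphM num_eq.
Qed.

End Substitution.

(** * The image of a derivation evaluated at linear forms *)

Lemma edges_nth (K : fieldType) (x : K) s :
  edges (x :: s) = \prod_(i < size s) (nth 0 (x :: s) i - nth 0 s i).
Proof.
elim: s x => [|y s IHs] x; first by rewrite big_ord0.
by rewrite edges_cons big_ord_recl /= -IHs.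
Qed.

Lemma prod_zip_enum (K : comNzRingType) n (f : 'I_n -> K) (es : seq nat) :
  size es = n ->
  \prod_(p <- zip [seq f i | i <- enum 'I_n] es) p.1 ^+ p.2 =
  \prod_(i < n) f i ^+ nth 0%N es i.
Proof.
move=> size_es.
have {1}-> : es = [seq nth 0%N es i | i : 'I_n <- enum 'I_n].
  rewrite [RHS](map_comp (nth 0%N es) val) val_enum_ord -size_es.
  by rewrite map_nth_iota0 // take_size.
by rewrite zip_map big_map big_enum.
Qed.

Lemma size_exponents w : size (exponents w) = (count_mem letter_b w).+1.
Proof.
elim: w => [|[] w IHw] //=; first by rewrite IHw.
by move: IHw; rewrite exponents_neq0 /= => ->.
Qed.

Section RationalFunctions.
Variable d : nat.
Notation K := {fraction (polynom d)}.
Implicit Types (z : 'I_d.+1 -> polynom d) (t : tensor) (delta : lie -> lie).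

Definition rat_to_ratfun : {rmorphism rat -> K} :=
  (@FracField.tofrac (polynom d)) \o (@mpolyC d.+1 rat).

Definition points z : seq K := [seq (z i)%:F | i <- enum 'I_d.+1].

Definition ell_numerator t : polynom d :=
  \sum_(w <- words_of t | (count_mem letter_b (w : seq bool) == d.+1) &&
                          (nth 0%N (exponents w) 0 == 0%N))
    (coeff w t)%:MP_[d.+1] *
    \prod_(j < d.+1) ('X_j : polynom d) ^+ nth 0%N (exponents w) j.+1.

Lemma ell_barE delta :
  ell_bar delta d = (ell_numerator (delta lie_a))%:F / (pls_denom d)%:F.
Proof.
rewrite /ell_bar /ell_numerator rmorph_sum /= mulr_suml big_mkcondr /=.
apply: eq_bigr => w _; rewrite /ell_word; case: ifP => _; last by rewrite mulr0.
by rewrite mulrA -tofracM.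
Qed.

Lemma last_points z : last 0 (points z) = (z ord_max)%:F.
Proof.
by rewrite /points enum_ordSr map_rcons last_rcons.
Qed.

(** The first difference along the points 0, z_1, ..., z_r is - z_1, hence the
    sign. *)
Lemma msubst_denom z : (msubst z (pls_denom d))%:F =
  - (edges (0 :: points z) * width (0 :: points z)).
Proof.
rewrite edges_nth /pls_denom !rmorphM /= !msubstX.
rewrite /width /= subr0 last_points -mulNr; congr (_ * _).
rewrite size_map size_enum_ord big_ord_recl /= sub0r -mulNr opprK.
have nthE (i : 'I_d.+1) : nth 0 (points z) i = (z i)%:F.
  by rewrite (nth_map ord0) ?size_enum_ord // nth_ord_enum.
rewrite -[0%N]/(val (@ord0 d)) nthE; congr (_ * _).
rewrite !rmorph_prod; apply: eq_bigr => i _ /=.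
rewrite !rmorphB /= !msubstX -!nthE.
by [].
Qed.

Lemma msubst_numerator z t : edges (0 :: points z) != 0 ->
  (msubst z (ell_numerator t))%:F =
  edges (0 :: points z) * eval rat_to_ratfun t (0 :: points z).
Proof.
move=> edges0; rewrite /eval monalg.mmapE big_distrr /=.
rewrite /ell_numerator (rmorph_sum (msubst z)) rmorph_sum /= big_mkcond /=.
apply: eq_bigr => w _.
rewrite (rmorphM (msubst z)) /= msubstC (rmorph_prod (msubst z)) /=.
have size_pts : size (0 :: points z) = d.+2.
  by rewrite /= size_map size_enum_ord.
have [count_w|count_w] := eqVneq (count_mem letter_b (w : seq bool)) d.+1;
  last first.
  by rewrite word_eval_size ?size_pts ?eqSS 1?eq_sym // !mulr0.
rewrite word_evalE ?size_pts ?count_w // [exponents w]exponents_neq0 /=.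
rewrite big_cons.
rewrite /points prod_zip_enum ?size_behead ?size_exponents ?count_w //.
set e0 := head _ _; case: eqVneq => [->|e0_neq0] /=; last first.
  by rewrite expr0n (negPf e0_neq0) !mul0r !mulr0.
rewrite expr0 mul1r [RHS]mulrCA [edges _ * _]mulrC divfK //.
rewrite tofracM rmorph_prod; congr (_ * _); apply: eq_bigr => i _ /=.
by rewrite rmorphXn /= msubstX tofracXn.
Qed.

Lemma pls_denom_neq0 : pls_denom d != 0.
Proof.
have X_neq0 i : 'X_i != 0 :> polynom d by rewrite -msupp_eq0 msuppX.
apply: mulf_neq0 => //; apply: mulf_neq0 => //; apply/prodf_neq0 => i _.
rewrite subr_eq0; apply/eqP => /(congr1 (mcoeff U_(widen_ord (leqnSn d) i)%MM)).
rewrite !mcoeffXU eqxx.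
have /negPf-> : lift ord0 i != widen_ord (leqnSn d) i.
  by rewrite -val_eqE /= /bump add1n eqn_leq ltnn.
by move/eqP; rewrite oner_eq0.
Qed.

Lemma edges_points_neq0 z : invertible z -> edges (0 :: points z) != 0.
Proof.
move=> z_inv; have : (msubst z (pls_denom d))%:F != 0.
  by rewrite tofrac_eq0 msubst_eq0 // pls_denom_neq0.
by apply: contraNneq => edges0; rewrite msubst_denom edges0 mul0r oppr0.
Qed.

(** Setting x_0 = 0 in the cyclic denominator gives that of the space of
    solutions, and kills exactly the words that begin with [a]. *)
Lemma ratfun_subst_ell delta z : invertible z ->
  ratfun_subst (ell_bar delta d) z =
  - der_eval rat_to_ratfun delta (0 :: points z).
Proof.
move=> z_inv; have edges0 := edges_points_neq0 z_inv.
rewrite ell_barE ratfun_substE ?pls_denom_neq0 //.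
rewrite msubst_numerator // msubst_denom /der_eval invrN mulrN invfM.
congr (- _).
by rewrite mulrACA divff // mul1r.
Qed.

Lemma ratfun_subst_comp delta z z' : invertible z -> invertible z' ->
  ratfun_subst (ratfun_subst (ell_bar delta d) z) z' =
  ratfun_subst (ell_bar delta d) (fun i => msubst z' (z i)).
Proof.
move=> z_inv z'_inv; rewrite ell_barE ratfun_substE ?pls_denom_neq0 //.
rewrite !ratfun_substE ?msubst_eq0 ?pls_denom_neq0 ?msubst_comp //.
exact: invertible_comp.
Qed.

End RationalFunctions.

(** * The linearised double shuffle equations *)

Section EdgeAlternality.
Variables (K : fieldType) (emb : {rmorphism rat -> K}).

Lemma width_partial_sums (ys : seq K) :
  width (partial_sums 0 ys) = \sum_(y <- ys) y.
Proof.
have last_scanl x : last x (scanl +%R x ys) = x + \sum_(y <- ys) y.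
  elim: ys x => [|y ys IHys] x; first by rewrite big_nil addr0.
  by rewrite /= IHys big_cons addrA.
by rewrite /width /= subr0 last_scanl add0r.
Qed.

(** The width is the sum of the differences, hence symmetric in them. *)
Lemma alternal_edges t : in_lie t ->
  alternal (fun ys : seq K =>
    eval emb t (partial_sums 0 ys) / width (partial_sums 0 ys)).
Proof.
move=> /(lie_series_exists emb)[phi [altphi phi0 phiE]] s r s_gt0 r_gt0.
transitivity ((\sum_(w <- shuffles s r) phi w) / \sum_(y <- s ++ r) y);
  last first.
  by rewrite altphi // mul0r.
rewrite mulr_suml; apply: eq_big_seq => w /shuffles_perm w_perm.
rewrite width_partial_sums (perm_big _ w_perm) phiE.
by case: w w_perm => [|y w] _; rewrite ?mulr0 addr0.
Qed.

(** F(0, x) = F(x, 0) by cyclic invariance, and F(x, 0) = F(0, - x) by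
    translation. *)
Lemma der_eval_opp d x : Der_Theta d ->
  der_eval emb d [:: 0; - x] = der_eval emb d [:: 0; x].
Proof.
move=> d_Theta; rewrite -(der_eval_rot1 emb 0 [:: x] d_Theta) /=.
have [phi [_ _ phiE]] : exists phi, lie_series emb
    (emb (coeff (fmu letter_a) (d lie_a))) (d lie_a) phi.
  exact/lie_series_exists/asboolP/lie_valP.
have := phiE 0 [:: - x]; have := phiE x [:: - x].
rewrite /partial_sums /= subrr add0r /der_eval /width /= => -> ->.
by rewrite sub0r subr0.
Qed.

End EdgeAlternality.

Section DoubleShuffle.
Variable d : nat.
Notation K := {fraction (polynom d)}.
Implicit Types (delta : lie -> lie) (s : 'S_d.+1).

Definition xfrac (i : 'I_d.+1) : K := ('X_i : polynom d)%:F.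

Lemma xfrac_inj : injective xfrac.
Proof.
move=> i j /eqP; rewrite tofrac_eq => /eqP/(congr1 (mcoeff U_(j)%MM)).
rewrite !mcoeffXU eqxx; case: eqVneq => // _ /eqP.
Qed.

Lemma xfrac_neq0 i : xfrac i != 0.
Proof. by rewrite tofrac_eq0 -msupp_eq0 msuppX. Qed.

Lemma perm_invertible s : invertible (fun i : 'I_d.+1 => 'X_(s i) : polynom d).
Proof. by exists (fun i => 'X_((s^-1)%g i)) => i; rewrite msubstX permK. Qed.

(** The inverse substitution takes consecutive differences of the variables,
    with the convention that the variable before the first one is 0. *)
Lemma partial_sum_invertible :
  invertible (fun i : 'I_d.+1 => \sum_(j < d.+1 | (j <= i)%N) 'X_j : polynom d).
Proof.
pose e j : polynom d := if j is j'.+1 then 'X_(inord j') else 0.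
exists (fun i => e i.+1 - e i) => i; rewrite raddf_sum /=.
under eq_bigr do rewrite msubstX.
transitivity (\sum_(j < i.+1) (e j.+1 - e j)).
  by rewrite (big_ord_widen d.+1 (fun j => e j.+1 - e j)).
rewrite -(big_mkord xpredT (fun j => e j.+1 - e j)) telescope_sumr // subr0.
by rewrite /= inord_val.
Qed.

Lemma opp_invertible : invertible (fun i : 'I_d.+1 => - 'X_i : polynom d).
Proof.
by exists (fun i => - 'X_i) => i; rewrite rmorphN /= msubstX opprK.
Qed.

Lemma shuffle_sum_vertices delta k : in_u_geom delta -> (0 < k < d.+1)%N ->
  shuffle_sum k (ell_bar delta d) = 0.
Proof.
move=> delta_geom /andP[k_gt0 k_le].
have [_ _ altF] := u_geom_vertex_alternal (rat_to_ratfun d) delta_geom.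
rewrite /shuffle_sum.
under eq_bigr => s _.
  rewrite ratfun_subst_ell; last exact: perm_invertible.
  rewrite [points _](map_comp xfrac s) -/(perm_word s).
  over.
rewrite sumrN (sum_shuffle_perm k
  (fun l => der_eval (rat_to_ratfun d) delta (0 :: [seq xfrac i | i <- l]))).
rewrite -(big_map (map xfrac) xpredT
  (fun l => der_eval (rat_to_ratfun d) delta (0 :: l))).
rewrite -map_shuffles -[RHS]oppr0; congr (- _).
set l1 := map _ _; set l2 := map _ _.
have l1_gt0 : (0 < size l1)%N.
  by rewrite size_map size_takel // size_enum_ord ltnW.
have l2_gt0 : (0 < size l2)%N.
  by rewrite size_map size_drop size_enum_ord subn_gt0.
rewrite -[RHS](altF 0 l1 l2) //.
apply: eq_big_seq => w /shuffles_perm w_perm; rewrite /der_generic.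
rewrite (perm_uniq (_ : perm_eq (0 :: w) (0 :: l1 ++ l2))) ?perm_cons //.
rewrite -map_cat cat_take_drop cons_uniq map_inj_uniq ?enum_uniq; last first.
  exact: xfrac_inj.
case: ifP => // /negP[]; rewrite andbT; apply/mapP => -[i _ /esym/eqP].
by rewrite (negPf (xfrac_neq0 i)).
Qed.

Lemma points_partial_sum_subst s :
  0 :: points (fun i => msubst (fun i => 'X_(s i))
                          (\sum_(j < d.+1 | (j <= i)%N) 'X_j)) =
  partial_sums 0 [seq xfrac i | i <- perm_word s].
Proof.
congr (_ :: _); apply: (@eq_from_nth _ 0) => [|n].
  by rewrite size_scanl !size_map.
rewrite size_map size_enum_ord => lt_n.
rewrite (nth_map ord0) ?size_enum_ord // -[n]/(val (Ordinal lt_n)) nth_ord_enum.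
rewrite nth_scanl; last first.
  by rewrite size_map (perm_size (perm_word_perm s)) size_enum_ord.
rewrite -2!map_take -map_comp.
rewrite (rmorph_sum (msubst _)) rmorph_sum /= foldlE big_cons /= add0r big_map.
rewrite [RHS](perm_big [seq j : 'I_d.+1 <- enum 'I_d.+1 | (j < n.+1)%N]) /=.
  by rewrite big_filter big_enum_cond; apply: eq_bigr => j _; rewrite msubstX.
apply: uniq_perm => [||j].
- by rewrite take_uniq ?enum_uniq.
- by rewrite filter_uniq ?enum_uniq.
by rewrite mem_take_enum mem_filter mem_enum andbT.
Qed.

Lemma shuffle_sum_edges delta k : in_u_geom delta -> (0 < k < d.+1)%N ->
  shuffle_sum k (sharp (ell_bar delta d)) = 0.
Proof.
move=> delta_geom /andP[k_gt0 k_le]; rewrite /shuffle_sum /sharp.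
have sum_inv := partial_sum_invertible.
under eq_bigr => s _.
  rewrite ratfun_subst_comp //; last exact: perm_invertible.
  rewrite ratfun_subst_ell; last first.
    by apply: invertible_comp => //; apply: perm_invertible.
  rewrite points_partial_sum_subst.
  over.
rewrite sumrN (sum_shuffle_perm k
  (fun l => der_eval (rat_to_ratfun d) delta
    (partial_sums 0 [seq xfrac i | i <- l]))).
rewrite -(big_map (map xfrac) xpredT
  (fun l => der_eval (rat_to_ratfun d) delta (partial_sums 0 l))).
rewrite -map_shuffles -[RHS]oppr0; congr (- _).
apply: (alternal_edges (rat_to_ratfun d)).
- exact/asboolP/lie_valP.
- by rewrite size_map size_takel // size_enum_ord ltnW.
by rewrite size_map size_drop size_enum_ord subn_gt0.
Qed.

End DoubleShuffle.

Lemma points_depth1 (z : 'I_1 -> polynom 0) : points z = [:: (z ord0)%:F].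
Proof.
by rewrite /points enum_ordSl [enum 'I_0]size0nil ?size_enum_ord.
Qed.

Lemma ell_bar_even delta : in_u_geom delta ->
  ell_bar delta 0 = ratfun_subst (ell_bar delta 0) (fun i => - 'X_i).
Proof.
move=> delta_geom.
have [d_Theta _ _] := u_geom_vertex_alternal (rat_to_ratfun 0) delta_geom.
have id_inv : invertible (fun i : 'I_1 => 'X_i : polynom 0).
  by exists (fun i => 'X_i) => i; rewrite msubstX.
have ell_id : ratfun_subst (ell_bar delta 0) (fun i => 'X_i) = ell_bar delta 0.
  by rewrite ell_barE ratfun_substE ?pls_denom_neq0 // !msubst_id.
rewrite -[LHS]ell_id !ratfun_subst_ell //; last exact: opp_invertible.
by rewrite !points_depth1 tofracN der_eval_opp.
Qed.

Lemma ell_bar_pls_depth delta d : in_u_geom delta ->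
  pls_depth (ell_bar delta d).
Proof.
move=> delta_geom.
split; first by exists (ell_numerator d (delta lie_a)); apply: ell_barE.
split=> [d0|_ k k_range]; first by subst d; apply: ell_bar_even.
by rewrite shuffle_sum_vertices // shuffle_sum_edges.
Qed.

Lemma ell_bar_finite delta :
  exists N, forall d, (N < d)%N -> ell_bar delta d = 0.
Proof.
pose depth (w : word) := count_mem letter_b (w : seq bool).
exists (\max_(w <- words_of (lie_val (delta lie_a))) depth w)%N => d lt_d.
rewrite /ell_bar big_seq_cond big1 // => w /andP[w_in /eqP depth_w].
have := leq_bigmax_seq (P := xpredT) (F := depth) w w_in isT.
by rewrite /depth depth_w leqNgt ltnS ltnW.
Qed.

Local Open Scope classical_set_scope.

Theorem proposition1p6 : ell_bar @` u_geom `<=` pls.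
Proof.
move=> _ [delta delta_geom <-]; split; last exact: ell_bar_finite.
by move=> d; apply: ell_bar_pls_depth.
Qed.
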